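(* Let $n\ge2$ and let $\mathbf{Y}_n^>$ be the $\mathbb{Z}[\frac12]$-subalgebra of $Y_n^>$ generated by $e_{i,r}^t/t!$ ($i\in I$, $r,t\in\mathbb{N}$). For each finitely supported function $h:\Delta^+\times\mathbb{N}\to\mathbb{N}$ put $$\mathbf{E}_h:=\prod^{\rightarrow}_{(\beta,r)\in\Delta^+\times\mathbb{N}}\frac{e_\beta(r)^{h(\beta,r)}}{h(\beta,r)!},$$ the product taken in increasing order with respect to the total order on $\Delta^+\times\mathbb{N}$ described in the context. Then $\{\mathbf{E}_h\}_{h}$, $h$ ranging over all finitely supported functions $\Delta^+\times\mathbb{N}\to\mathbb{N}$, is a basis of the $\mathbb{Z}[\frac12]$-module $\mathbf{Y}_n^>$.
   Context: $\mathbb{N}=\{0,1,2,\dots\}$, $I=\{1,\dots,n-1\}$, $(c_{ij})$ the Cartan matrix of $\mathfrak{sl}_n$ ($c_{ii}=2$, $c_{i,i\pm1}=-1$, otherwise $0$). $Y_n^>$ is the $\mathbb{C}$-algebra generated by $e_{i,r}$ ($i\in I,r\in\mathbb{N}$) with relations $[e_{i,r+1},e_{j,s}]-[e_{i,r},e_{j,s+1}]=\frac{c_{ij}}{2}(e_{i,r}e_{j,s}+e_{j,s}e_{i,r})$; $[e_{i,r},e_{j,s}]=0$ if $c_{ij}=0$; $[e_{i,r_1},[e_{i,r_2},e_{j,s}]]+[e_{i,r_2},[e_{i,r_1},e_{j,s}]]=0$ if $c_{ij}=-1$. $\Delta^+=\{[i,j]:1\le i\le j\le n-1\}$ where $[i,j]=\alpha_i+\dots+\alpha_j$.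 For $\beta=[i,j]$, $e_\beta(r):=[\cdots[[e_{i,r},e_{i+1,0}],e_{i+2,0}],\dots,e_{j,0}]$. Order on $\Delta^+$: $[i,j]\le[i',j']$ iff $i<i'$, or $i=i'$ and $j\le j'$. Order on $\Delta^+\times\mathbb{N}$: $(\beta,r)\le(\beta',r')$ iff $\beta<\beta'$, or $\beta=\beta'$ and $r\ge r'$. *)

(* Defs.v *)
From HB Require Import structures.
From mathcomp Require Import all_boot all_order all_algebra.
From mathcomp Require Import complex reals.
From mathcomp Require Import finmap.
Set Implicit Arguments. Unset Strict Implicit. Unset Printing Implicit Defensive.
Import Order.TTheory GRing.Theory Num.Theory.
Local Open Scope ring_scope.

Notation CC R := (complex R).

Definition cartan (i j : nat) : int :=
  if i == j then Posz 2
  else if (i == j.+1) || (j == i.+1) then Negz 0 else Posz 0.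

Definition inI (n i : nat) : bool := ((1 <= i) && (i <= n.-1))%N.

Definition comm {A : pzRingType} (x y : A) : A := x * y - y * x.

Definition yangian_rels (R : realType) (n : nat) (A : algType (CC R))
    (e : nat -> nat -> A) : Prop :=
  (forall i j r s, inI n i -> inI n j ->
     comm (e i r.+1) (e j s) - comm (e i r) (e j s.+1)
     = ((cartan i j)%:~R / 2%:R : CC R) *: (e i r * e j s + e j s * e i r))
  /\ (forall i j r s, inI n i -> inI n j -> cartan i j = Posz 0 ->
     comm (e i r) (e j s) = 0)
  /\ (forall i j r1 r2 s, inI n i -> inI n j -> cartan i j = Negz 0 ->
     comm (e i r1) (comm (e i r2) (e j s)) + comm (e i r2) (comm (e i r1) (e j s)) = 0).

(* (A, e) is the algebra presented by these generators and relations,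
   i.e. it satisfies the universal property of Y_n^>. *)
Definition is_Yplus (R : realType) (n : nat) (A : algType (CC R))
    (e : nat -> nat -> A) : Prop :=
  yangian_rels n e /\
  forall (B : algType (CC R)) (e' : nat -> nat -> B), yangian_rels n e' ->
    exists f : {lrmorphism A -> B},
      (forall i r, inI n i -> f (e i r) = e' i r) /\
      (forall g : {lrmorphism A -> B},
         (forall i r, inI n i -> g (e i r) = e' i r) -> f =1 g).

Definition dyadic (R : realType) (x : CC R) : Prop :=
  exists (m : int) (k : nat), x = m%:~R / (2%:R ^+ k).

Definition divpow (R : realType) (A : algType (CC R)) (x : A) (t : nat) : A :=
  ((t`!)%:R : CC R)^-1 *: x ^+ t.

Inductive Ybold (R : realType) (n : nat) (A : algType (CC R))
    (e : nat -> nat -> A) : A -> Prop :=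
| Yb_gen i r t : inI n i -> Ybold n e (divpow (e i r) t)
| Yb_one : Ybold n e 1
| Yb_zero : Ybold n e 0
| Yb_add x y : Ybold n e x -> Ybold n e y -> Ybold n e (x + y)
| Yb_mul x y : Ybold n e x -> Ybold n e y -> Ybold n e (x * y)
| Yb_scale (c : CC R) x : dyadic c -> Ybold n e x -> Ybold n e (c *: x).

(* Positive roots [i,j] = alpha_i + ... + alpha_j, 1 <= i <= j <= n-1. *)
Definition is_root (n : nat) (p : nat * nat) : bool :=
  ((1 <= p.1) && (p.1 <= p.2) && (p.2 <= n.-1))%N.
Definition proot (n : nat) := {p : nat * nat | is_root n p}.

Definition rkey (n : nat) := (proot n * nat)%type.

Definition rkey_le (n : nat) (a b : rkey n) : bool :=
  let: (i, j) := val a.1 in let: (i', j') := val b.1 in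
  (i < i')%N || ((i == i') && ((j < j')%N || ((j == j') && (b.2 <= a.2)%N))).

Definition e_root (R : realType) (A : algType (CC R)) (e : nat -> nat -> A)
    (i j r : nat) : A :=
  foldl (fun x k => comm x (e k 0%N)) (e i r) (iota i.+1 (j - i)).

Definition fsupp_fun (n : nat) := {fsfun rkey n -> nat with 0%N}.

(* E_h = ordered product over (beta,r) in increasing order of
   e_beta(r)^{h(beta,r)} / h(beta,r)!  (factors with h = 0 are 1, so the
   product over the support suffices). *)
Definition Eh (R : realType) (n : nat) (A : algType (CC R)) (e : nat -> nat -> A)
    (h : fsupp_fun n) : A :=
  \prod_(k <- sort (@rkey_le n) (finsupp h))
     divpow (e_root e (val k.1).1 (val k.1).2 k.2) (h k).

Definition dyadic_basis (R : realType) (A : algType (CC R)) (T : eqType)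
    (M : A -> Prop) (E : T -> A) : Prop :=
  (forall h, M (E h)) /\
  (forall y, M y -> exists (s : seq T) (c : T -> CC R),
      (forall h, dyadic (c h)) /\ y = \sum_(h <- s) c h *: E h) /\
  (forall (s : seq T) (c : T -> CC R), uniq s -> (forall h, dyadic (c h)) ->
      \sum_(h <- s) c h *: E h = 0 -> forall h, h \in s -> c h = 0).

(* Main.v *)
Require Import Defs.
From HB Require Import structures.
From mathcomp Require Import all_boot all_order all_algebra.
From mathcomp Require Import complex reals.
From mathcomp Require Import finmap.
From mathcomp Require Import boolp mpoly ring zify.

(* Spanning over C is a straightening argument for the filtration of Y_n^> by total loop degree:
   modulo lower degree the e_beta(r) bracket like root vectors of the current algebra n_+[t].
   Integrality and independence come from representations. Put N particles with parameters
   a_1, ..., a_N on the vertices 0, ..., n and let e_{i,r} hop one particle across the edge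
   (i, i+1) with weight (a_k + i/2)^r times a product over the other particles. By a Lagrange
   interpolation identity the divided powers e_{i,r}^t/t! act with coefficients in
   Z[1/2][a_1, ..., a_N], hence so does the whole integral form. To recover the coefficient of
   E_h in a combination of ordered monomials, take h maximal for (loop degree, length), use one
   particle travelling from i to j+1 for each factor e_[i,j](r) of E_h, and read off
   the coefficient of the monomial prod_k a_k^(r_k) in the top degree part of the corresponding
   matrix entry. Up to a product of differences a_k - a_l, division by which preserves
   integrality, only E_h contributes, and its contribution is 1. So the coordinates of an
   element of the integral form lie in Z[1/2]; applied to all the multiples of a linear relation
   this also gives independence. *)

Set Implicit Arguments. Unset Strict Implicit. Unset Printing Implicit Defensive.
Import Order.TTheory GRing.Theory Num.Theory.
Local Open Scope ring_scope.

(** Independent particles cannot work: for two particles on one edge the relation with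
    [cartan i i = 2] forces their hops not to commute, so every hop must feel all the other
    particles. In the amplitude the state enters only through a constant added to the linear form
    a_k - a_l. The top degree part is therefore the same for all states and edges and comes out of
    the sum over intermediate states; what is left is a tensor product of evaluation representations
    of n_+[t] at the points a_k, where coefficients are found by counting. The shift by i/2 in the
    weight absorbs the halves in the defining relations, so that hops on adjacent edges are
    exchanged with integral coefficients. Length enters the choice of [h] because of an asymmetry: a
    product with fewer factors than particles cannot move all of them, but a longer one of the same
    loop degree can, several factors carrying one particle in stages, and would pollute the
    coefficient. *)

Definition opmx (W : finType) (w0 : W) (K : comNzRingType) := {ffun W * W -> K^o}.

(** * Matrices indexed by a finite type, and restriction of scalars *)

Section OperatorMatrices.
Variables (W : finType) (w0 : W) (K : comNzRingType).
Local Notation M := (opmx w0 K).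

HB.instance Definition _ := GRing.Lmodule.copy M {ffun W * W -> K^o}.

Definition mulop (x y : M) : M := [ffun p => \sum_u x (p.1, u) * y (u, p.2)].
Definition oneop : M := [ffun p => (p.1 == p.2)%:R].

Fact mulopA : associative mulop.
Proof.
move=> x y z; apply/ffunP=> -[s t]; rewrite !ffunE /=.
under eq_bigr do rewrite ffunE mulr_sumr.
rewrite exchange_big; apply: eq_bigr => u _.
by rewrite ffunE mulr_suml; apply: eq_bigr => v _; rewrite mulrA.
Qed.

Fact mul1op : left_id oneop mulop.
Proof.
move=> x; apply/ffunP=> -[s t]; rewrite ffunE /= (bigD1 s) //= ffunE eqxx mul1r.
rewrite big1 ?addr0 // => u /negPf us.
by rewrite ffunE /= eq_sym us mul0r.
Qed.

Fact mulop1 : right_id oneop mulop.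
Proof.
move=> x; apply/ffunP=> -[s t]; rewrite ffunE /= (bigD1 t) //= ffunE eqxx mulr1.
rewrite big1 ?addr0 // => u /negPf us.
by rewrite ffunE /= us mulr0.
Qed.

Fact mulopDl : left_distributive mulop +%R.
Proof.
move=> x y z; apply/ffunP=> -[s t]; rewrite !ffunE -big_split.
by apply: eq_bigr => u _; rewrite ffunE mulrDl.
Qed.

Fact mulopDr : right_distributive mulop +%R.
Proof.
move=> x y z; apply/ffunP=> -[s t]; rewrite !ffunE -big_split.
by apply: eq_bigr => u _; rewrite ffunE mulrDr.
Qed.

(** The point [w0] in the type of matrices serves here: an inhabited index set makes the ring
    nonzero. *)
Fact oneop_neq0 : oneop != 0.
Proof. by apply/eqP=> /ffunP /(_ (w0, w0)) /eqP; rewrite !ffunE eqxx oner_eq0. Qed.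

HB.instance Definition _ := GRing.Zmodule_isNzRing.Build M
  mulopA mul1op mulop1 mulopDl mulopDr oneop_neq0.

Fact opmx_scaleAl (a : K) (x y : M) : a *: (x * y) = (a *: x) * y.
Proof.
apply/ffunP=> -[s t]; rewrite !ffunE /= scaler_sumr; apply: eq_bigr => u _.
by rewrite ffunE scalerAl.
Qed.

Fact opmx_scaleAr (a : K) (x y : M) : a *: (x * y) = x * (a *: y).
Proof.
apply/ffunP=> -[s t]; rewrite !ffunE /= scaler_sumr; apply: eq_bigr => u _.
by rewrite ffunE scalerAr.
Qed.

HB.instance Definition _ := GRing.Lmodule_isLalgebra.Build K M opmx_scaleAl.
HB.instance Definition _ := GRing.Lalgebra_isAlgebra.Build K M opmx_scaleAr.

Lemma opmxM (x y : M) s t : (x * y) (s, t) = \sum_u x (s, u) * y (u, t).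
Proof. by rewrite ffunE. Qed.

Lemma opmx1 s t : (1 : M) (s, t) = (s == t)%:R.
Proof. by rewrite ffunE. Qed.

End OperatorMatrices.

(** The universal property of Y_n^> reaches only algebras over [CC R], while the representations
    have polynomial coefficients. The alias records [phi] so that the restricted structure can be
    inferred. *)
Definition restr_scalars (F K : comNzRingType) (phi : F -> K) (B : Type) := B.

Section RestrictScalars.
Variables (F K : comNzRingType) (phi : {rmorphism F -> K}) (B : algType K).
Local Notation RB := (restr_scalars phi B).

HB.instance Definition _ := GRing.NzRing.on RB.

Definition restr_scale (c : F) (x : RB) : RB := phi c *: (x : B).

Fact restr_scaleA a b v : restr_scale a (restr_scale b v) = restr_scale (a * b) v.
Proof. by rewrite /restr_scale scalerA rmorphM. Qed.
Fact restr_scale1 : left_id 1 restr_scale.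
Proof. by move=> v; rewrite /restr_scale rmorph1 scale1r. Qed.
Fact restr_scaleDr : right_distributive restr_scale +%R.
Proof. by move=> a u v; rewrite /restr_scale scalerDr. Qed.
Fact restr_scaleDl v : {morph restr_scale^~ v : a b / a + b}.
Proof. by move=> a b; rewrite /restr_scale rmorphD scalerDl. Qed.

HB.instance Definition _ := GRing.Zmodule_isLmodule.Build F RB
  restr_scaleA restr_scale1 restr_scaleDr restr_scaleDl.

Fact restr_scaleAl (a : F) (x y : RB) : a *: (x * y) = (a *: x) * y.
Proof. exact: scalerAl. Qed.
HB.instance Definition _ := GRing.Lmodule_isLalgebra.Build F RB restr_scaleAl.
Fact restr_scaleAr (a : F) (x y : RB) : a *: (x * y) = x * (a *: y).
Proof. exact: scalerAr. Qed.
HB.instance Definition _ := GRing.Lalgebra_isAlgebra.Build F RB restr_scaleAr.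

Lemma restr_scaleE (a : F) (x : RB) : a *: x = (phi a *: (x : B) : B).
Proof. by []. Qed.

End RestrictScalars.

(** * Particle representations *)

Section ParticleModel.
Variables (N n : nat) (K : comNzRingType) (a : 'I_N -> K) (hlf : K).

Definition state := {ffun 'I_N -> 'I_n.+1}.
Definition state0 : state := [ffun=> ord0].
Definition raise (s : state) (k : 'I_N) : state :=
  [ffun l => if l == k then inord (s l).+1 else s l].

Local Notation B := (opmx state0 K).
Implicit Types (s t : state) (k l : 'I_N).

(* With this amplitude, hops of distinct particles [k], [l] satisfy, for [x := a k - a l],
   [(x - 1) hop k i * hop l i = (x + 1) hop l i * hop k i] and
   [x hop k i * hop l i.+1 = (x - 1) hop l i.+1 * hop k i]. *)
Definition hop_amp (i : nat) (s : state) (k : 'I_N) : K :=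
  \prod_(l | l != k) (a k - a l - (s l == i.+1 :> nat)%:R).

(** Rows are the states before the move. In a product the leftmost factor thus moves first, and its
    amplitude is read off the starting state. *)
Definition hop (k : 'I_N) (i : nat) : B :=
  [ffun p : state * state => (p.1 k == i :> nat)%:R * hop_amp i p.1 k * (raise p.1 k == p.2)%:R].

(** The term [i%:R * hlf] turns the coefficients [x -+ hlf] of the relation between adjacent edges
    into the pair [x], [x - 1]. *)
Definition spectral (k : 'I_N) (i : nat) : K := a k + i%:R * hlf.

Definition particle_e (i r : nat) : B := \sum_k spectral k i ^+ r *: hop k i.

Lemma raiseE s k l : (s k < n)%N -> raise s k l = (s l + (l == k))%N :> nat.
Proof.
move=> sk; rewrite ffunE; have [->|] := eqVneq l k; last by rewrite addn0.
by rewrite inordK ?addn1.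
Qed.

Lemma raise_id s k : (s k < n)%N -> raise s k k = (s k).+1 :> nat.
Proof. by move=> sk; rewrite raiseE // eqxx addn1. Qed.

Lemma raise_neq s k l : l != k -> raise s k l = s l.
Proof. by move=> /negPf lk; rewrite ffunE lk. Qed.

Lemma raiseC s k l : raise (raise s k) l = raise (raise s l) k.
Proof.
apply/ffunP=> p; rewrite !ffunE.
by case: (eqVneq p k) => [pk|]; case: (eqVneq p l) => [pl|].
Qed.

Lemma hopE k i s t :
  hop k i (s, t) = (s k == i :> nat)%:R * hop_amp i s k * (raise s k == t)%:R.
Proof. by rewrite ffunE. Qed.

Lemma hopM k i (x : B) s t :
  (hop k i * x) (s, t) = (s k == i :> nat)%:R * hop_amp i s k * x (raise s k, t).
Proof.
rewrite opmxM (bigD1 (raise s k)) //= hopE eqxx mulr1 big1 ?addr0 // => u /negPf ru.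
by rewrite hopE [raise s k == u]eq_sym ru mulr0 mul0r.
Qed.

Definition hop_amp_off (p : pred 'I_N) (i : nat) (s : state) (k : 'I_N) : K :=
  \prod_(l | (l != k) && p l) (a k - a l - (s l == i.+1 :> nat)%:R).

Lemma hop_ampD1 i s k l : l != k ->
  hop_amp i s k = (a k - a l - (s l == i.+1 :> nat)%:R) * hop_amp_off (predC1 l) i s k.
Proof. by move=> lk; rewrite /hop_amp (bigD1 l). Qed.

Lemma hop_ampD2 i s k l m : l != k -> m != k -> l != m ->
  hop_amp i s k = (a k - a l - (s l == i.+1 :> nat)%:R) *
    (a k - a m - (s m == i.+1 :> nat)%:R) *
    hop_amp_off [predC (pred2 l m)] i s k.
Proof.
move=> lk mk lm; rewrite (hop_ampD1 _ _ lk) /hop_amp_off (bigD1 m) /= ?mk 1?eq_sym // mulrA.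
by congr (_ * _); apply: eq_bigl => p; rewrite negb_or andbA.
Qed.

Lemma hop_amp_off_raise p i s k l : (l == k) || ~~ p l ->
  hop_amp_off p i (raise s l) k = hop_amp_off p i s k.
Proof.
move=> h; apply: eq_bigr => m /andP[mk pm]; rewrite raise_neq //.
by apply: contraTneq h => <-; rewrite (negPf mk) pm.
Qed.

Lemma hop_same k i j : (i < n)%N -> j != i.+1 -> hop k i * hop k j = 0.
Proof.
move=> lin ji; apply/ffunP=> -[s t]; rewrite hopM hopE [RHS]ffunE.
case: eqP => [ski|]; last by rewrite !mul0r.
have skn : (s k < n)%N by rewrite ski.
by rewrite raiseE // eqxx addn1 ski eq_sym (negPf ji) /= mul0r mul0r mulr0.
Qed.

(** Both orders end in the same state, and the only amplitude factors sensitive to the order are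
    those in which [k] and [l] see each other. The last hypothesis compares exactly these. *)
Lemma hop_mix k l i j (x c d : K) : (i < n)%N -> (j < n)%N -> k != l ->
  x = a k - a l ->
  c * ((x - (j == i.+1)%:R) * (- x - (i.+1 == j.+1)%:R))
    = d * ((x - (j.+1 == i.+1)%:R) * (- x - (i == j.+1)%:R)) ->
  c *: (hop k i * hop l j) = d *: (hop l j * hop k i).
Proof.
move=> lin ljn kl xE E; have lk : l != k by rewrite eq_sym.
apply/ffunP=> -[s t]; rewrite ffunE [RHS]ffunE !hopM !hopE /=.
rewrite raiseC !raise_neq //.
have [ski|] := eqVneq (s k : nat) i; last by rewrite !(mul0r, mulr0, scaler0).
have [slj|] := eqVneq (s l : nat) j; last by rewrite !(mul0r, mulr0, scaler0).
have skn : (s k < n)%N by rewrite ski.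
have sln : (s l < n)%N by rewrite slj.
rewrite !(hop_ampD1 _ _ lk) !(hop_ampD1 _ _ kl).
rewrite !hop_amp_off_raise /= ?eqxx ?orbT //.
rewrite !raise_id // ski slj -(opprB (a k) (a l)) -xE.
set g := hop_amp_off _ i s k; set g' := hop_amp_off _ j s l.
rewrite /GRing.scale /=.
transitivity ((c * ((x - (j == i.+1)%:R) * (- x - (i.+1 == j.+1)%:R))) *
  (g * g' * (raise (raise s l) k == t)%:R)); first by ring.
by rewrite E; ring.
Qed.

End ParticleModel.

Lemma comm_sumZ (K : comNzRingType) (B : algType K) (I J : finType)
  (a : I -> K) (b : J -> K) (x : I -> B) (y : J -> B) :
  comm (\sum_i a i *: x i) (\sum_j b j *: y j) =
    \sum_(p : I * J) (a p.1 * b p.2) *: comm (x p.1) (y p.2).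
Proof.
rewrite /comm !mulr_suml; under eq_bigr do rewrite mulr_sumr.
under [X in _ - X]eq_bigr do rewrite mulr_sumr.
rewrite [X in _ - X]exchange_big !pair_bigA -sumrB; apply: eq_bigr => -[i j] _ /=.
by rewrite scalerBr -!scalerAl -!scalerAr !scalerA [b j * _]mulrC.
Qed.

Lemma mul_sumZ (K : comNzRingType) (B : algType K) (I J : finType)
  (a : I -> K) (b : J -> K) (x : I -> B) (y : J -> B) :
  (\sum_i a i *: x i) * (\sum_j b j *: y j) =
    \sum_(p : I * J) (a p.1 * b p.2) *: (x p.1 * y p.2).
Proof.
rewrite !mulr_suml; under eq_bigr do rewrite mulr_sumr.
rewrite pair_bigA; apply: eq_bigr => -[i j] _ /=.
by rewrite -!scalerAl -!scalerAr !scalerA.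
Qed.

Lemma mul_sumZC (K : comNzRingType) (B : algType K) (I J : finType)
  (a : I -> K) (b : J -> K) (x : I -> B) (y : J -> B) :
  (\sum_j b j *: y j) * (\sum_i a i *: x i) =
    \sum_(p : I * J) (a p.1 * b p.2) *: (y p.2 * x p.1).
Proof.
rewrite !mulr_suml; under eq_bigr do rewrite mulr_sumr.
rewrite exchange_big pair_bigA; apply: eq_bigr => -[i j] _ /=.
by rewrite -!scalerAl -!scalerAr !scalerA mulrC.
Qed.

Lemma opmxD (W : finType) (w0 : W) (K : comNzRingType) (x y : opmx w0 K) p :
  (x + y) p = x p + y p.
Proof. exact: ffunE. Qed.

Lemma opmxN (W : finType) (w0 : W) (K : comNzRingType) (x : opmx w0 K) p :
  (- x) p = - x p.
Proof. exact: ffunE. Qed.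

(** * Exchange relations between hops *)

Section ParticleRelations.
Variables (N n : nat) (K : comNzRingType) (a : 'I_N -> K) (hlf : K).
Hypothesis hlf2 : hlf + hlf = 1.

Local Notation B := (opmx (state0 N n) K).
Local Notation hop := (@hop N n K a).
Local Notation e := (@particle_e N n K a hlf).
Local Notation spectral := (spectral a hlf).
Implicit Types (s t : state N n) (k l : 'I_N).

Lemma cartan_far i j : cartan i j = 0 -> [/\ i != j, i != j.+1 & j != i.+1].
Proof. by rewrite /cartan; case: eqP => // _; do 2!case: eqP => //. Qed.

Lemma cartan_near i j : cartan i j = Negz 0 -> (i == j.+1) || (j == i.+1).
Proof. by rewrite /cartan; case: eqP => // _; case: ifP. Qed.

Lemma hop_quadratic i j k l (ch := (cartan i j)%:~R * hlf) : (i < n)%N -> (j < n)%N ->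
  (spectral k i - spectral l j) *: comm (hop k i) (hop l j) =
    ch *: (hop k i * hop l j + hop l j * hop k i).
Proof.
move=> lin ljn; set x := spectral k i; set y := spectral l j.
suff: (x - y - ch) *: (hop k i * hop l j) = (x - y + ch) *: (hop l j * hop k i).
  move=> /eqP; rewrite scalerBl subr_eq => /eqP E.
  rewrite /comm scalerBr E scalerDl scalerDr [in RHS]addrC.
  by rewrite -[X in X - _]addrA [X in X - _]addrC addrK.
have xyE : x - y = (a k - a l) + (i%:R - j%:R) * hlf by rewrite /x /y /spectral; ring.
have [kl|kl] := eqVneq k l.
  rewrite {}xyE /ch -{l y}kl subrr add0r.
  have [ij|ij] := eqVneq i j.
    by rewrite -ij !hop_same ?scaler0 // eqn_leq ltnn andbF.
  (* One particle crosses two consecutive edges. Only the product in the wrong order vanishes by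
     itself; the other one is killed by its coefficient, where the half-integral shift cancels
     [ch]. *)
  have [ji|ji] := eqVneq j i.+1.
    rewrite ji [hop k i.+1 * _]hop_same -?ji ?scaler0 ?ji ?ltn_eqF // -?ji //.
    rewrite /cartan ji eqn_leq ltnn andbF /= eqxx orbT.
    rewrite (_ : (i%:R - i.+1%:R) * hlf - _ = 0) ?scale0r //.
    by rewrite NegzE /=; ring.
  have [ij'|ij'] := eqVneq i j.+1.
    rewrite ij' [hop k j.+1 * _]hop_same -?ij' ?scaler0 ?ij' ?ltn_eqF // -?ij' //.
    rewrite /cartan ij' eqn_leq ltnn /= eqxx.
    rewrite (_ : (j.+1%:R - j%:R) * hlf + _ = 0) ?scale0r //.
    by rewrite NegzE /=; ring.
  by rewrite !hop_same ?scaler0.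
rewrite {}xyE /ch /cartan; set z := a k - a l.
have [<-|ij] := eqVneq i j.
  apply: (@hop_mix _ _ _ _ _ _ _ _ z) => //.
  rewrite eqxx (_ : (i == i.+1) = false) ?ltn_eqF //=.
  transitivity ((z - (hlf + hlf)) * (z * (- z - 1))); first by ring.
  transitivity ((z + (hlf + hlf)) * ((z - 1) * - z)); last by ring.
  by rewrite hlf2; ring.
have [iE|ij'] := eqVneq i j.+1.
  apply: (@hop_mix _ _ _ _ _ _ _ _ z) => //; rewrite iE.
  have -> : (j == j.+2) = false by lia.
  have -> : (j.+2 == j.+1) = false by lia.
  have -> : (j.+1 == j.+2) = false by lia.
  rewrite !eqxx ?orbT /= NegzE.
  transitivity ((z + (hlf + hlf)) * (z * - z)); first by ring.
  transitivity (z * (z * (- z - 1))); last by ring.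
  by rewrite hlf2; ring.
have [jE|ji] := eqVneq j i.+1.
  apply: (@hop_mix _ _ _ _ _ _ _ _ z) => //; rewrite jE.
  have -> : (i == i.+2) = false by lia.
  have -> : (i.+2 == i.+1) = false by lia.
  have -> : (i.+1 == i.+2) = false by lia.
  rewrite !eqxx ?orbT /= NegzE.
  transitivity (z * ((z - 1) * - z)); first by ring.
  transitivity ((z - (hlf + hlf)) * (z * (- z))); last by ring.
  by rewrite hlf2; ring.
apply: (@hop_mix _ _ _ _ _ _ _ _ z) => //.
by rewrite !eqSS /= (negPf ji) (negPf ij') (negPf ij) eq_sym (negPf ij) /=; ring.
Qed.

End ParticleRelations.

(** * Serre relations for hops, by coincidences among the three particles *)

Section ParticleSerre.
Variables (N n : nat) (K : comNzRingType) (a : 'I_N -> K).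

Local Notation B := (opmx (state0 N n) K).
Local Notation hop := (@hop N n K a).
Implicit Types (s t : state N n) (k l : 'I_N).

Let serre k1 k2 l i j := comm (hop k1 i) (comm (hop k2 i) (hop l j))
  + comm (hop k2 i) (comm (hop k1 i) (hop l j)).

Let serreC k1 k2 l i j : serre k1 k2 l i j = serre k2 k1 l i j.
Proof. exact: addrC. Qed.

(** All terms reach the same state and share the factors that involve outside particles. The mutual
    factors of the three particles leave a polynomial identity in the differences of their
    parameters. *)
Lemma serre_distinct i j k1 k2 l : (i < n)%N -> (j < n)%N -> cartan i j = Negz 0 ->
  k1 != k2 -> k1 != l -> k2 != l -> serre k1 k2 l i j = 0.
Proof.
move=> lin ljn /cartan_near cij n12 n1l n2l.
have [n21 nl1 nl2] : [/\ k2 != k1, l != k1 & l != k2] by rewrite ![_ == k1]eq_sym [l == k2]eq_sym.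
have [E1 E2 E3 E4] : [/\ (i == i.+1) = false, (j == j.+1) = false, (i == j) = false & (j == i) = false].
  by case/orP: cij => /eqP ->; split; lia.
apply/ffunP=> -[s t]; rewrite [RHS]ffunE /serre /comm.
rewrite !mulrBr !mulrBl -!mulrA !(opmxD, opmxN) !hopM !hopE /=.
rewrite !raise_neq //.
have -> : raise (raise (raise s k1) l) k2 = raise (raise (raise s k1) k2) l by rewrite raiseC.
have -> : raise (raise (raise s k2) k1) l = raise (raise (raise s k1) k2) l by rewrite (raiseC s).
have -> : raise (raise (raise s k2) l) k1 = raise (raise (raise s k1) k2) l by rewrite raiseC (raiseC s).
have -> : raise (raise (raise s l) k1) k2 = raise (raise (raise s k1) k2) l.
  by rewrite (raiseC s) raiseC.
have -> : raise (raise (raise s l) k2) k1 = raise (raise (raise s k1) k2) l.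
  by rewrite (raiseC s) raiseC (raiseC s).
have [s1|] := eqVneq (s k1 : nat) i; last by move=> _ /=; ring.
have [s2|] := eqVneq (s k2 : nat) i; last by move=> _ /=; ring.
have [sl|] := eqVneq (s l : nat) j; last by move=> _ /=; ring.
have s1n : (s k1 < n)%N by rewrite s1.
have s2n : (s k2 < n)%N by rewrite s2.
have sln : (s l < n)%N by rewrite sl.
rewrite !(hop_ampD2 _ _ _ n21 nl1 n2l) !(hop_ampD2 _ _ _ n12 nl2 n1l) !(hop_ampD2 _ _ _ n1l n2l n12).
rewrite !hop_amp_off_raise /= ?eqxx ?orbT //.
all: rewrite ?inE ?eqxx ?orbT //.
rewrite !(raise_id, raise_neq) // s1 s2 sl !eqSS E1.
move: (hop_amp_off _ _ _ _ k1) (hop_amp_off _ _ _ _ k2) (hop_amp_off _ _ _ _ l) => g1 g2 gl.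
case/orP: cij => /eqP ->.
  have -> : (j == j.+2) = false by lia.
  have -> : (j.+1 == j) = false by lia.
  by rewrite !eqxx ?E2 /=; ring.
have -> : (i == i.+2) = false by lia.
have -> : (i.+1 == i) = false by lia.
by rewrite !eqxx ?E1 /=; ring.
Qed.

(** The shared particle crosses both edges, necessarily the lower one first, so its starting vertex
    is decided by which of [i], [j] is smaller. *)
Lemma serre_shared i j k1 k2 : (i < n)%N -> (j < n)%N -> cartan i j = Negz 0 ->
  k1 != k2 -> serre k1 k2 k1 i j = 0.
Proof.
move=> lin ljn /cartan_near cij n12.
have n21 : k2 != k1 by rewrite eq_sym.
have [E1 E2 E3 E4] : [/\ (i == i.+1) = false, (j == j.+1) = false, (i == j) = false & (j == i) = false].
  by case/orP: cij => /eqP ->; split; lia.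
apply/ffunP=> -[s t]; rewrite [RHS]ffunE /serre /comm.
rewrite !mulrBr !mulrBl -!mulrA !(opmxD, opmxN) !hopM !hopE /=.
rewrite ?(raise_neq _ n12) ?(raise_neq _ n21).
have -> : raise (raise (raise s k1) k1) k2 = raise (raise (raise s k1) k2) k1 by rewrite raiseC.
have -> : raise (raise (raise s k2) k1) k1 = raise (raise (raise s k1) k2) k1 by rewrite (raiseC s).
have [s2|] := eqVneq (s k2 : nat) i; last by move=> _ /=; ring.
have s2n : (s k2 < n)%N by rewrite s2.
have r22 : raise s k2 k2 = i.+1 :> nat by rewrite raise_id // s2.
have r122 : raise (raise s k1) k2 k2 = i.+1 :> nat by rewrite raise_id ?raise_neq // s2.
have r211 : raise (raise s k2) k1 k1 = raise s k1 k1 by rewrite ffunE eqxx raise_neq // [RHS]ffunE eqxx.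
rewrite !(hop_ampD1 _ _ _ n21) !(hop_ampD1 _ _ _ n12).
rewrite !hop_amp_off_raise ?inE ?eqxx ?orbT //.
rewrite ?(raise_neq _ n12) ?(raise_neq _ n21) r22 r122 r211 s2.
move: (hop_amp_off _ _ _ _ k2) (hop_amp_off _ _ _ s k1) (hop_amp_off _ _ _ s k1) => g2 g1 h1.
rewrite eqSS E1 eqxx.
have [si|_] := eqVneq (s k1 : nat) i.
  have sn : (s k1 < n)%N by rewrite si.
  have r11 : raise s k1 k1 = i.+1 :> nat by rewrite raise_id // si.
  rewrite r11 ?si ?E1 ?E2 ?E3 ?E4 !eqxx (_ : (i.+1 == i) = false); last by lia.
  case/orP: cij => /eqP cij.
    by rewrite (_ : (i.+1 == j) = false) /=; [ring | lia].
  have -> : raise (raise s k1) k1 k1 = j.+1 :> nat by rewrite raise_id r11 ?cij // -cij.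
  have F1 : (i.+1 == i) = false by lia.
  have F2 : (i == i.+2) = false by lia.
  by rewrite cij !eqSS ?eqxx ?E1 ?F1 ?F2 /=; ring.
have [sj|_] := eqVneq (s k1 : nat) j; last by rewrite /=; ring.
have sn : (s k1 < n)%N by rewrite sj.
have r11 : raise s k1 k1 = j.+1 :> nat by rewrite raise_id // sj.
rewrite r11 ?sj.
case/orP: cij => /eqP cij; last first.
  by rewrite (_ : (j.+1 == i) = false) /=; [ring | lia].
have -> : raise (raise s k1) k1 k1 = i.+1 :> nat by rewrite raise_id r11 -?cij.
have F1 : (j.+1 == j) = false by lia.
have F2 : (j == j.+2) = false by lia.
by rewrite cij !eqSS ?eqxx ?E2 ?F1 ?F2 /=; ring.
Qed.

(** Positions only increase, so no particle crosses the edge [i] twice, not even with another hop in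
    between. *)
Lemma serre_diag i j k l : (i < n)%N -> (j < n)%N -> cartan i j = Negz 0 ->
  serre k k l i j = 0.
Proof.
move=> lin ljn /cartan_near cij.
have hh : hop k i * hop k i = 0 by rewrite hop_same ?ltn_eqF.
have hvh : hop k i * (hop l j * hop k i) = 0.
  apply/ffunP=> -[s t]; rewrite !hopM hopE [RHS]ffunE.
  have [si|] := eqVneq (s k : nat) i; last by rewrite !mul0r.
  have sn : (s k < n)%N by rewrite si.
  have rk : raise s k k = i.+1 :> nat by rewrite raise_id // si.
  have [rj|] := eqVneq (raise s k l : nat) j; last by rewrite !(mul0r, mulr0).
  have -> : (raise (raise s k) l k == i :> nat) = false.
    have [kl|kl] := eqVneq k l; last by rewrite raise_neq // rk; lia.
    by move: rj; rewrite -kl rk => rj; rewrite raise_id rk ?rj //; lia.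
  by rewrite !(mul0r, mulr0).
rewrite /serre /comm !mulrBr !mulrBl -!mulrA hvh [hop k i * (hop k i * _)]mulrA hh mul0r mulr0.
by rewrite !subr0 addr0.
Qed.

Lemma hop_serre i j k1 k2 l : (i < n)%N -> (j < n)%N -> cartan i j = Negz 0 ->
  comm (hop k1 i) (comm (hop k2 i) (hop l j))
  + comm (hop k2 i) (comm (hop k1 i) (hop l j)) = 0.
Proof.
move=> lin ljn cij; rewrite -/(serre k1 k2 l i j).
have [<-|n12] := eqVneq k1 k2; first exact: serre_diag.
have [<-|n1l] := eqVneq k1 l; first exact: serre_shared.
have [<-|n2l] := eqVneq k2 l; last exact: serre_distinct.
by rewrite serreC; apply: serre_shared; rewrite // eq_sym.
Qed.

End ParticleSerre.

Lemma inI_lt n i : inI n i -> (i < n)%N.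
Proof. by rewrite /inI; case: n => [|m] /andP[]; lia. Qed.

Section ParticleRelations.
Variables (N n : nat) (K : comNzRingType) (a : 'I_N -> K) (hlf : K).
Hypothesis hlf2 : hlf + hlf = 1.
Local Notation e := (@particle_e N n K a hlf).
Local Notation spectral := (spectral a hlf).

Lemma particle_comm i j r s : comm (e i r) (e j s) = \sum_(p : 'I_N * 'I_N)
    (spectral p.1 i ^+ r * spectral p.2 j ^+ s) *: comm (hop n a p.1 i) (hop n a p.2 j).
Proof. exact: comm_sumZ. Qed.

Lemma particle_quadratic i j r s : (i < n)%N -> (j < n)%N ->
  comm (e i r.+1) (e j s) - comm (e i r) (e j s.+1) =
    ((cartan i j)%:~R * hlf) *: (e i r * e j s + e j s * e i r).
Proof.
move=> lin ljn; rewrite !particle_comm.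
rewrite [e i r * _]mul_sumZ [e j s * _]mul_sumZC -big_split -sumrB scaler_sumr.
apply: eq_bigr => -[k l] _ /=.
rewrite -scalerBl -scalerDr scalerA [_ * (_ * spectral l j ^+ s)]mulrC -scalerA.
rewrite -(hop_quadratic _ hlf2) // scalerA; congr (_ *: _).
by rewrite !exprS; ring.
Qed.

Lemma particle_far i j r s : (i < n)%N -> (j < n)%N -> cartan i j = 0 ->
  comm (e i r) (e j s) = 0.
Proof.
move=> lin ljn /cartan_far[ij ij' ji'].
rewrite particle_comm big1 // => -[k l] _ /=.
rewrite (_ : comm _ _ = 0) ?scaler0 //; apply/eqP; rewrite subr_eq0.
have [<-|kl] := eqVneq k l; first by rewrite !hop_same.
apply/eqP; rewrite -[LHS]scale1r -[RHS]scale1r; apply: hop_mix => //.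
by rewrite !eqSS (negPf ij) (eq_sym j i) (negPf ij) (negPf ij') (negPf ji').
Qed.

Lemma particle_serre i j r1 r2 s : (i < n)%N -> (j < n)%N -> cartan i j = Negz 0 ->
  comm (e i r1) (comm (e i r2) (e j s)) + comm (e i r2) (comm (e i r1) (e j s)) = 0.
Proof.
move=> lin ljn cij.
have E p q : comm (e i p) (comm (e i q) (e j s)) = \sum_(x : 'I_N * ('I_N * 'I_N))
    (spectral x.1 i ^+ p * (spectral x.2.1 i ^+ q * spectral x.2.2 j ^+ s)) *:
      comm (hop n a x.1 i) (comm (hop n a x.2.1 i) (hop n a x.2.2 j)).
  by rewrite particle_comm comm_sumZ.
rewrite !E.
(* Exchanging the two particles on the edge [i] in the second sum gives both sums the same spectral
   weights, and [hop_serre] applies to each triple. *)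
pose f (x : 'I_N * ('I_N * 'I_N)) := (x.2.1, (x.1, x.2.2)).
have fK : involutive f by case=> ? [].
rewrite [X in _ + X](reindex_inj (inv_inj fK)) -big_split big1 // => -[k1 [k2 l]] _ /=.
by rewrite (mulrCA (spectral k2 i ^+ _)) -scalerDr hop_serre ?scaler0.
Qed.

End ParticleRelations.

Section ParticleRepresentation.
Variables (R : realType) (N n : nat) (K : comNzRingType) (phi : {rmorphism CC R -> K}).
Variable (a : 'I_N -> K).
Local Notation B := (restr_scalars phi (opmx (state0 N n) K)).

Lemma particle_yangian :
  yangian_rels n (particle_e n a (phi 2%:R^-1) : nat -> nat -> B).
Proof.
have phi_half : phi 2%:R^-1 + phi 2%:R^-1 = 1.
  rewrite -rmorphD -[RHS](rmorph1 phi); congr (phi _).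
  by rewrite -mulr2n -[LHS]mulr_natr mulVf ?pnatr_eq0.
split; [|split].
- move=> i j r s /inI_lt lin /inI_lt ljn.
  rewrite restr_scaleE rmorphM rmorph_int; exact: particle_quadratic.
- move=> i j r s /inI_lt lin /inI_lt ljn; exact: particle_far.
- move=> i j r1 r2 s /inI_lt lin /inI_lt ljn; exact: particle_serre.
Qed.

End ParticleRepresentation.

(** * Integrality of divided powers *)

(** The difference of the products of the ['X - x l + 1] and of the ['X - x l] has degree below
    [#|S|], so it equals its Lagrange interpolant at the points [x k], which is the sum of the
    [c k *: L k]. The identity compares the coefficients of degree [#|S|.-1]. *)
Lemma lagrange_shift_sum (F : fieldType) (I : finType) (S : {set I}) (x : I -> F) :
  {in S &, injective x} ->
  \sum_(k in S) \prod_(l in S :\ k) ((x k - x l + 1) / (x k - x l)) = #|S|%:R.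
Proof.
move=> xI; have [->|[k0 k0S]] := set_0Vmem S; first by rewrite big_set0 cards0.
have Spos : (0 < #|S|)%N by apply/card_gt0P; exists k0.
pose c k := \prod_(l in S :\ k) ((x k - x l + 1) / (x k - x l)).
pose P (d : F) : {poly F} := \prod_(y <- [seq x l - d | l <- enum S]) ('X - y%:P).
pose L k : {poly F} := \prod_(y <- [seq x l | l <- enum (S :\ k)]) ('X - y%:P).
pose D := P 1 - P 0 - \sum_(k in S) c k *: L k.
have szP d : size (P d) = #|S|.+1 by rewrite size_prod_XsubC size_map cardE.
have szL k : k \in S -> size (L k) = #|S|.
  by move=> kS; rewrite size_prod_XsubC size_map -cardE (cardsD1 k S) kS.
have PE d z : (P d).[z] = \prod_(l in S) (z - x l + d).
  rewrite horner_prod big_map big_enum /=; apply: eq_bigr => l _.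
  by rewrite hornerXsubC opprD opprK addrA.
have LE k z : (L k).[z] = \prod_(l in S :\ k) (z - x l).
  by rewrite horner_prod big_map big_enum /=; apply: eq_bigr => l _; rewrite hornerXsubC.
have cP d : (P d)`_(#|S|.-1) = - \sum_(l in S) (x l - d).
  have -> : #|S|.-1 = (size [seq x l - d | l <- enum S]).-1 by rewrite size_map cardE.
  by rewrite coefPn_prod_XsubC ?big_map ?big_enum // size_map -cardE -lt0n.
have szD : (size D <= #|S|)%N.
  apply/leq_sizeP => j; rewrite leq_eqVlt => jS.
  rewrite !coefB coef_sum [X in _ - X]big1 ?subr0.
    case/orP: jS => [/eqP <-|jS]; last by rewrite !nth_default ?szP ?subrr.
    have mon d : (P d)`_#|S| = 1.
      by have := monic_prod_XsubC [seq x l - d | l <- enum S] predT id;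
         rewrite monicE /lead_coef szP => /eqP.
    by rewrite !mon subrr.
  move=> k kS; rewrite coefZ nth_default ?mulr0 // szL //.
  by case/orP: jS => [/eqP <-|/ltnW].
have D0 : D = 0.
  apply: contraTeq szD => Dn0; rewrite -ltnNge.
  have -> : #|S| = size [seq x l | l <- enum S] by rewrite size_map cardE.
  apply: max_poly_roots => //; last first.
    by rewrite map_inj_in_uniq ?enum_uniq // => u v; rewrite !mem_enum; apply: xI.
  apply/allP => y /mapP[k]; rewrite mem_enum => kS ->.
  rewrite rootE; have -> : D.[x k] = (P 1).[x k] - (P 0).[x k] - c k * \prod_(l in S :\ k) (x k - x l).
    rewrite /D !(hornerD, hornerN) horner_sum (bigD1 k kS) /= hornerZ big1 ?addr0 ?LE //.
    move=> m /andP[mS mk].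
    by rewrite hornerZ LE (bigD1 k) /= ?subrr ?mul0r ?mulr0 // !inE eq_sym mk.
  rewrite !PE [X in _ - X - _](bigD1 k kS) /= subrr addr0 mul0r subr0.
  rewrite /c -big_split /= (bigD1 k kS) /= subrr add0r mul1r.
  rewrite (eq_bigl (fun l => l \in S :\ k)) => [|l]; last by rewrite !inE andbC.
  rewrite subr_eq0; apply/eqP/eq_bigr => l; rewrite !inE => /andP[lk lS].
  rewrite mulfVK // subr_eq0; apply: contraNneq lk => E.
  by rewrite (xI _ _ lS kS).
have := congr1 (fun q : {poly F} => q`_(#|S|.-1)) D0.
rewrite !coefB coef_sum coef0 !cP => /eqP; rewrite subr_eq0 => /eqP E.
transitivity (\sum_(k in S) (c k *: L k)`_#|S|.-1).
  apply: eq_bigr => k kS; rewrite coefZ.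
  have := monic_prod_XsubC [seq x l | l <- enum (S :\ k)] predT id.
  by rewrite monicE /lead_coef szL // => /eqP ->; rewrite mulr1.
rewrite -E opprK addrC -sumrB -sumr_const; apply: eq_bigr => k _.
by rewrite subr0 opprB addrC subrK.
Qed.

Lemma exchange_ratio (F : fieldType) (p g u v : F) : u - v != 0 ->
  p * ((v - u - 1) * g) = (u - v + 1) / (u - v) * (p * ((v - u) * g)).
Proof. by move=> uv; field. Qed.

Lemma opmxMn (W : finType) (w0 : W) (K : comNzRingType) (x : opmx w0 K) q p :
  (x *+ q) p = x p *+ q.
Proof. by elim: q => [|q IHq]; rewrite ?mulr0n ?mulrS ?opmxD ?IHq // ffunE. Qed.

Section DividedPowers.
Variables (N n : nat) (K : comNzRingType) (F : fieldType) (iota : {rmorphism K -> F}).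
Variables (a : 'I_N -> K) (hlf : K).
Hypothesis iotaI : injective iota.
Hypothesis aI : injective a.
Local Notation B := (opmx (state0 N n) K).
Local Notation e := (@particle_e N n K a hlf).
Implicit Types (s : state N n) (k l : 'I_N) (S : {set 'I_N}).

Definition amp (i r : nat) s k : K := spectral a hlf k i ^+ r * hop_amp a i s k.

Definition raise_set s S : state N n :=
  [ffun l => if l \in S then inord (s l).+1 else s l].

(** Closed form of the [m]-th divided power of [particle_e i r]: a set of [m] particles hops at
    once, all amplitudes being taken in the starting state. No denominators occur. *)
Definition divided_hop (i r m : nat) : B :=
  [ffun p : state N n * state N n => \sum_(S : {set 'I_N} | #|S| == m)
     ([forall k in S, p.1 k == i :> nat] && (raise_set p.1 S == p.2))%:R
       * \prod_(k in S) amp i r p.1 k].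

(* Moving [k] multiplies the amplitude of every other particle [l] of [S] by
   [(a k - a l + 1) / (a k - a l)]. *)
Lemma amp_exchange i r s S : (i < n)%N -> {in S, forall k, s k = i :> nat} ->
  \sum_(k in S) amp i r s k * \prod_(l in S :\ k) amp i r (raise s k) l
    = #|S|%:R * \prod_(l in S) amp i r s l.
Proof.
move=> lin Si; apply: iotaI.
rewrite rmorphM rmorph_nat rmorph_sum /=.
rewrite -(@lagrange_shift_sum _ _ S (fun k => iota (a k))); last by move=> k l _ _ /iotaI /aI.
rewrite mulr_suml; apply: eq_bigr => k kS; rewrite [in RHS](bigD1 k kS) /=.
rewrite !rmorphM /= mulrCA; congr (_ * _).
rewrite !rmorph_prod (eq_bigl (fun l => (l \in S) && (l != k))) => [|l]; last by rewrite !inE andbC.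
rewrite [in RHS](eq_bigl (fun l => (l \in S) && (l != k))) => [|l]; last by rewrite !inE andbC.
rewrite -big_split /=; apply: eq_bigr => l /andP[lS lk].
have kl : k != l by rewrite eq_sym.
have nz : iota (a k) - iota (a l) != 0 .
  by rewrite subr_eq0; apply: contraNneq kl => /iotaI /aI ->.
rewrite /amp !(hop_ampD1 _ _ _ kl) hop_amp_off_raise ?inE ?eqxx ?orbT //.
have skn : (s k < n)%N by rewrite Si.
rewrite raise_id // Si // eqxx ltn_eqF // subr0 /=.
rewrite !rmorphM !rmorphB rmorph1 /=.
exact: exchange_ratio.
Qed.
Lemma raise_set_raise s S k : k \notin S -> raise_set (raise s k) S = raise_set s (k |: S).
Proof.
move=> kS; apply/ffunP=> l; rewrite !ffunE !inE.
by have [->|lk] := eqVneq l k; rewrite ?(negPf kS).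
Qed.

(** Paths are grouped by the set [T] of all particles that hop. The sum over the particle of [T]
    that goes first is evaluated by [amp_exchange], and this produces the factor [m.+1]. *)
Lemma particle_divided_hop i r m : (i < n)%N ->
  e i r * divided_hop i r m = divided_hop i r m.+1 *+ m.+1.
Proof.
move=> lin; apply/ffunP=> -[s t].
transitivity (\sum_k (s k == i :> nat)%:R * amp i r s k * divided_hop i r m (raise s k, t)).
  rewrite /particle_e mulr_suml sum_ffunE; apply: eq_bigr => k _.
  rewrite -scalerAl ffunE hopM /amp /GRing.scale /=.
  by rewrite !mulrA [spectral _ _ _ _ ^+ _ * _]mulrC.
rewrite opmxMn -[RHS]mulr_natl [divided_hop _ _ m.+1 _]ffunE /= mulr_sumr.
transitivity (\sum_(T : {set 'I_N} | #|T| == m.+1) \sum_(k in T)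
   ([forall l in T, s l == i :> nat] && (raise_set s T == t))%:R *
     (amp i r s k * \prod_(l in T :\ k) amp i r (raise s k) l)); last first.
  apply: eq_bigr => T /eqP cT; rewrite -mulr_sumr.
  case: andP => [[/forall_inP Ti _]|_]; last by rewrite !mul0r mulr0.
  by rewrite !mul1r amp_exchange // ?cT // => l lT; apply/eqP/Ti.
rewrite (exchange_big_dep predT) //=; apply: eq_bigr => k _.
rewrite (reindex_onto (fun S => k |: S) (fun T => T :\ k)) /=; last first.
  by move=> T /andP[_ kT]; rewrite setD1K.
rewrite ffunE /= mulr_sumr big_mkcond [RHS]big_mkcond; apply: eq_bigr => S _ /=.
rewrite setU11 andbT.
have [kS|kS] := boolP (k \in S).
  have -> : (k |: S) :\ k == S = false.
    by apply/negbTE/eqP => /setP /(_ k); rewrite !inE eqxx kS.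
  rewrite andbF; case: eqP => // _.
  have [sk|] := eqVneq (s k : nat) i; last by rewrite !mul0r.
  have -> : [forall l in S, raise s k l == i :> nat] = false.
    apply/negbTE/forall_inPn; exists k => //.
    by rewrite raise_id sk // eq_sym ltn_eqF.
  by rewrite mul0r mulr0.
rewrite setU1K // eqxx andbT cardsU1 kS add1n eqSS; case: eqP => // _.
rewrite raise_set_raise // mulrACA -natrM mulnb andbA.
congr ((nat_of_bool (_ && _))%:R * _).
apply/andP/forall_inP => [[/eqP sk /forall_inP h] l|h].
  rewrite !inE => /predU1P[->|lS]; first exact/eqP.
  by have := h l lS; rewrite raise_neq //; apply: contraNneq kS => <-.
split; first by apply: h; rewrite setU11.
apply/forall_inP => l lS; rewrite raise_neq; last by apply: contraNneq kS => <-.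
by apply: h; rewrite !inE lS orbT.
Qed.

Lemma divided_hop0 i r : divided_hop i r 0 = 1.
Proof.
apply/ffunP=> -[s t]; rewrite opmx1 ffunE /= (big_pred1 set0) => [|S]; last by rewrite cards_eq0.
rewrite big_set0 mulr1; congr (nat_of_bool _)%:R.
have -> : raise_set s set0 = s by apply/ffunP=> k; rewrite ffunE inE.
by case: eqP; rewrite ?andbF // andbT => _; apply/forall_inP => k; rewrite inE.
Qed.

Lemma particle_eX i r m : (i < n)%N -> e i r ^+ m = divided_hop i r m *+ m`!.
Proof.
move=> lin; elim: m => [|m IHm]; first by rewrite divided_hop0.
by rewrite exprS IHm mulrnAr particle_divided_hop // -mulrnA factS.
Qed.

Lemma particle_divpow (c : K) i r m : (i < n)%N -> m`!%:R * c = 1 ->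
  c *: e i r ^+ m = divided_hop i r m.
Proof. by move=> lin mc; rewrite particle_eX // -scalerMnr scalerMnl -mulr_natl mc scale1r. Qed.

Lemma divided_hop_in (S : subringClosed K) i r m p : (forall k, a k \in S) -> hlf \in S ->
  divided_hop i r m p \in S.
Proof.
move=> aS hS; rewrite ffunE; apply: rpred_sum => T _.
apply: rpredM; first exact: rpred_nat.
apply: rpred_prod => k _; apply: rpredM.
  by apply/rpredX/rpredD => //; apply: rpredM => //; apply: rpred_nat.
by apply: rpred_prod => l _; rewrite !rpredB ?rpred_nat.
Qed.

End DividedPowers.

(** * The subring Z[1/2] of the scalars *)

Section Dyadic.
Variable R : realType.

Definition dyadic_pred : {pred CC R} := fun x => `[< dyadic x >].

Fact dyadic_subring : subring_closed dyadic_pred.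
Proof.
have nz k : (2%:R : CC R) ^+ k != 0 by rewrite expf_neq0 // pnatr_eq0.
split=> [|x y /asboolP[m [k ->]] /asboolP[p [q ->]]|x y /asboolP[m [k ->]] /asboolP[p [q ->]]].
- by apply/asboolP; exists 1, 0%N; rewrite expr0 divr1.
- apply/asboolP; exists (m * 2%:R ^+ q - p * 2%:R ^+ k), (k + q)%N.
  rewrite -mulNr addf_div // -exprD mulNr; congr (_ / _).
  by rewrite rmorphB !rmorphM !rmorphXn.
- apply/asboolP; exists (m * p), (k + q)%N.
  by rewrite mulf_div -exprD rmorphM.
Qed.

HB.instance Definition _ := GRing.isSubringClosed.Build (CC R) dyadic_pred dyadic_subring.

Lemma dyadic_half : 2%:R^-1 \in dyadic_pred.
Proof. by apply/asboolP; exists 1, 1%N; rewrite expr1 mul1r. Qed.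

(** A scalar outside Z[1/2] is what turns integrality of coordinates into linear independence. *)
Lemma third_not_dyadic : ~ dyadic (3%:R^-1 : CC R).
Proof.
case=> m [k] E; have nz : (2%:R : CC R) ^+ k != 0 by rewrite expf_neq0 // pnatr_eq0.
have {}E : (2%:R : CC R) ^+ k = m%:~R * 3%:R.
  by rewrite -(divfK nz m%:~R) -E mulrAC mulVf ?pnatr_eq0 // mul1r.
have {}E : (2 ^ k)%N%:Z = m * 3.
  by apply: (@intr_inj (CC R)); rewrite rmorphM /= -E -natrX.
have : (3 %| 2 ^ k)%N by rewrite -[(2 ^ k)%N]/(`|(2 ^ k)%N%:Z|%N) E abszM dvdn_mull.
by rewrite Euclid_dvdX // => /andP[].
Qed.

End Dyadic.

Lemma fraction_embedding (K : idomainType) :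
  exists (F : fieldType) (iota : {rmorphism K -> F}), injective iota.
Proof.
by exists {fraction K}, (@tofrac K) => x y /eqP; rewrite tofrac_eq => /eqP.
Qed.

Section ParticleIntegrality.
Variables (R : realType) (N n : nat) (K : comNzRingType) (phi : {rmorphism CC R -> K}).
Variables (F : fieldType) (iota : {rmorphism K -> F}) (a : 'I_N -> K) (S : subringClosed K).
Hypothesis iotaI : injective iota.
Hypothesis aI : injective a.
Hypothesis aS : forall k, a k \in S.
Hypothesis phiS : forall c, dyadic c -> phi c \in S.
Local Notation B := (restr_scalars phi (opmx (state0 N n) K)).

Lemma Ybold_entries (A : algType (CC R)) (e : nat -> nat -> A) (f : {lrmorphism A -> B}) :
  (forall i r, inI n i -> f (e i r) = particle_e n a (phi 2%:R^-1) i r) ->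
  forall y, Ybold n e y -> forall p, (f y : opmx (state0 N n) K) p \in S.
Proof.
move=> fe y; elim=> {y}.
- move=> i r t iI p; rewrite linearZ /= rmorphXn /= fe //.
  have phi_fact : t`!%:R * phi (t`!%:R^-1) = 1.
    have nz : (t`!%:R : CC R) != 0 by rewrite pnatr_eq0 -lt0n fact_gt0.
    by rewrite -(rmorph_nat phi) -[LHS]rmorphM mulfV // rmorph1.
  have E := particle_divpow (phi 2%:R^-1) iotaI aI r (inI_lt iI) phi_fact.
  have hS : phi 2%:R^-1 \in S by apply/phiS; move/asboolP: (dyadic_half R).
  by have := divided_hop_in i r t p aS hS; rewrite -E.
- by move=> [s t]; rewrite rmorph1 opmx1 rpred_nat.
- by move=> p; rewrite rmorph0 ffunE rpred0.
- by move=> x y _ IHx _ IHy p; rewrite rmorphD opmxD rpredD.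
- by move=> x y _ IHx _ IHy [s t]; rewrite rmorphM opmxM rpred_sum // => u _; rewrite rpredM.
- by move=> c x dc _ IHx p; rewrite linearZ /= restr_scaleE ffunE rpredM // phiS.
Qed.

End ParticleIntegrality.

(** * The representation with indeterminate parameters *)

Section SiteParameters.
Variables (R : realType) (N n : nat).
Local Notation site_ring := {poly {mpoly (CC R)[N]}}.
Local Notation site_const := (polyC \o @mpolyC N (CC R)).

Definition site_int : {pred site_ring} := fun p => `[< forall i m, dyadic (p`_i@_m) >].

Lemma site_intP (p : site_ring) :
  reflect (forall i m, p`_i@_m \in @dyadic_pred R) (p \in site_int).
Proof. by apply: (iffP (asboolP _)) => h i m; [apply/asboolP/h | apply/asboolP/h]. Qed.

Fact site_int_subring : subring_closed site_int.
Proof.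
split=> [|p q /site_intP hp /site_intP hq|p q /site_intP hp /site_intP hq]; apply/site_intP => i m.
- by rewrite coef1 -mpolyC_nat mcoeffC rpredM ?rpred_nat.
- by rewrite coefB mcoeffB rpredB.
rewrite coefM raddf_sum rpred_sum // => j _ /=.
by rewrite mcoeffM rpred_sum // => k _; rewrite rpredM.
Qed.

HB.instance Definition _ := GRing.isSubringClosed.Build site_ring site_int site_int_subring.

(** The outer variable ['X] is a grading variable: the total degree in the parameters becomes the
    degree of a univariate polynomial, and a top degree part becomes a single coefficient. *)
Definition site_param (k : 'I_N) : site_ring := 'X_k *: 'X.

Lemma site_param_inj : injective site_param.
Proof.
move=> k l /(congr1 (fun p : site_ring => p`_1)).
rewrite !coefZ !coefX eqxx !mulr1 => /(congr1 (mcoeff U_(k)%MM))/eqP.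
by rewrite !mcoeffXU eqxx; have [->|] := eqVneq l k; rewrite // oner_eq0.
Qed.

Lemma site_constP c : (site_const c \in site_int) = (c \in @dyadic_pred R).
Proof.
apply/site_intP/idP => [/(_ 0%N 0%MM)|cd i m]; first by rewrite coefC mcoeffC eqxx mulr1.
by rewrite coefC; case: eqP => _; rewrite ?mcoeff0 ?rpred0 // mcoeffC rpredM ?rpred_nat.
Qed.

Lemma site_param_int k : site_param k \in site_int.
Proof.
apply/site_intP => i m; rewrite coefZ coefX mulr_natr mcoeffMn rpredMn //.
by rewrite mcoeffX rpred_nat.
Qed.

Local Notation B := (restr_scalars site_const (opmx (state0 N n) site_ring)).
Definition site_e (i r : nat) : B := particle_e n site_param (site_const 2%:R^-1) i r.

Lemma site_yangian : yangian_rels n site_e.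
Proof. exact: particle_yangian. Qed.

Lemma Ybold_int (A : algType (CC R)) (e : nat -> nat -> A) (f : {lrmorphism A -> B}) :
  (forall i r, inI n i -> f (e i r) = site_e i r) ->
  forall y, Ybold n e y -> forall p, (f y : opmx (state0 N n) site_ring) p \in site_int.
Proof.
have [F [iota iotaI]] : exists (F : fieldType) (iota : {rmorphism site_ring -> F}), injective iota.
  exact: fraction_embedding.
move=> fe; apply: (@Ybold_entries R N n _ site_const _ iota site_param site_int) fe => //.
- exact: site_param_inj.
- exact: site_param_int.
by move=> c dc; rewrite site_constP; apply/asboolP.
Qed.

End SiteParameters.

(** * Leading terms of matrix entries *)

Section LeadingCoefficient.
Variable K : comNzRingType.
Implicit Types (p q : {poly K}) (c : K).

(** [c] may be zero, so [d] is only a bound on the degree. This makes the relation compatible with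
    sums and products without any case distinction on cancellation. *)
Definition has_top (d : nat) p c := (size p <= d.+1)%N /\ p`_d = c.

Lemma has_top0 d : has_top d 0 0.
Proof. by split; rewrite ?size_poly0 ?coef0. Qed.

Lemma has_topC c : has_top 0 c%:P c.
Proof. by split; rewrite ?size_polyC_leq1 ?coefC. Qed.

Lemma has_topD d p q c c' : has_top d p c -> has_top d q c' -> has_top d (p + q) (c + c').
Proof.
move=> [sp cp] [sq cq]; split; last by rewrite coefD cp cq.
by rewrite (leq_trans (size_polyD _ _)) // geq_max sp sq.
Qed.

Lemma has_topM d d' p q c c' :
  has_top d p c -> has_top d' q c' -> has_top (d + d') (p * q) (c * c').
Proof.
move=> [sp cp] [sq cq]; split.
  by rewrite (leq_trans (size_polyMleq _ _)) //; lia.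
rewrite coefM (bigD1 (inord d)) //= inordK ?ltnS ?leq_addr // addKn cp cq.
rewrite big1 ?addr0 // => i ine.
have [id|di|ie] := ltngtP i d.
- by rewrite [q`_ _]nth_default ?mulr0 // (leq_trans sq) //; lia.
- by rewrite nth_default ?mul0r // (leq_trans sp).
by move/eqP: ine; case; apply/val_inj; rewrite /= inordK -?ie // ltnS leq_addr.
Qed.

Lemma has_top_lt d d' p c : (d < d')%N -> has_top d p c -> has_top d' p 0.
Proof.
move=> dd' [sp _]; split; first by rewrite (leq_trans sp) // ltnS ltnW.
by rewrite nth_default // (leq_trans sp).
Qed.

Lemma has_topX d r p c : has_top d p c -> has_top (d * r) (p ^+ r) (c ^+ r).
Proof.
move=> tp; elim: r => [|r IHr]; first by rewrite muln0; apply: has_topC.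
by rewrite !exprS mulnS; apply: has_topM.
Qed.

Lemma has_top_prod (I : finType) (P : pred I) (p : I -> {poly K}) (c : I -> K) :
  (forall i, P i -> has_top 1 (p i) (c i)) ->
  has_top #|P| (\prod_(i | P i) p i) (\prod_(i | P i) c i).
Proof.
move=> tp; rewrite -sum1_card.
elim/big_rec3: _ => [|i x y z Pi IH]; first exact: has_topC.
by apply: has_topM => //; apply: tp.
Qed.

Lemma has_top_sum (I : finType) d (p : I -> {poly K}) (c : I -> K) :
  (forall i, has_top d (p i) (c i)) -> has_top d (\sum_i p i) (\sum_i c i).
Proof.
move=> tp; elim/big_rec2: _ => [|i x y _ IH]; first exact: has_top0.
exact: has_topD.
Qed.

End LeadingCoefficient.

(** * Symbols of matrices of polynomials *)

Section Symbols.
Variables (R : realType) (N n : nat).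
Local Notation mpol := {mpoly (CC R)[N]}.
Local Notation site_ring := {poly mpol}.
Local Notation site_const := (polyC \o @mpolyC N (CC R)).
Local Notation Bz := (opmx (state0 N n) site_ring).
Local Notation B0 := (opmx (state0 N n) mpol).
Implicit Types (s t u : state N n) (k l : 'I_N) (M : Bz) (F : B0).

Definition below s t := [forall k, s k <= t k]%N.
Definition rise s t : nat := (\sum_k (t k - s k))%N.
Definition site_disc k : mpol := \prod_(l | l != k) ('X_k - 'X_l).
Definition rise_disc s t : mpol := \prod_k site_disc k ^+ (t k - s k).

Lemma below_trans t s u : below s t -> below t u -> below s u.
Proof. by move=> /forallP st /forallP tu; apply/forallP => k; apply: leq_trans (tu k). Qed.

Lemma riseD s t u : below s t -> below t u -> rise s u = (rise s t + rise t u)%N.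
Proof.
move=> /forallP st /forallP tu; rewrite /rise -big_split; apply: eq_bigr => k _ /=.
by have := st k; have := tu k; lia.
Qed.

Lemma rise_discM s t u : below s t -> below t u ->
  rise_disc s u = rise_disc s t * rise_disc t u.
Proof.
move=> /forallP st /forallP tu; rewrite /rise_disc -big_split; apply: eq_bigr => k _ /=.
by rewrite -exprD; congr (_ ^+ _); have := st k; have := tu k; lia.
Qed.

(* Every elementary hop multiplies by a polynomial of degree [N.-1] in the formal variable,
   with top coefficient [site_disc k]; the symbol discounts these contributions. *)
Definition has_symbol (d : nat) M F := forall s t,
  if below s t then has_top (d + N.-1 * rise s t) (M (s, t)) (rise_disc s t * F (s, t))
  else M (s, t) = 0 /\ F (s, t) = 0.

Lemma symbol0 d : has_symbol d 0 0.
Proof.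
by move=> s t; rewrite !ffunE; case: ifP => // _; rewrite mulr0; apply: has_top0.
Qed.

Lemma symbolD d M M' F F' :
  has_symbol d M F -> has_symbol d M' F' -> has_symbol d (M + M') (F + F').
Proof.
move=> sM sM' s t; have := sM s t; have := sM' s t; rewrite !opmxD.
case: ifP => _; last by move=> [-> ->] [-> ->]; rewrite !addr0.
by move=> h' h; rewrite mulrDr; apply: has_topD.
Qed.

Lemma symbol_sum (I : finType) d (M : I -> Bz) (F : I -> B0) :
  (forall i, has_symbol d (M i) (F i)) -> has_symbol d (\sum_i M i) (\sum_i F i).
Proof.
move=> h; elim/big_rec2: _ => [|i x y _ IH]; first exact: symbol0.
exact: symbolD.
Qed.

Lemma symbolZ d c M F : has_symbol d M F -> has_symbol d (site_const c *: M) (c%:MP *: F).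
Proof.
move=> sM s t; have := sM s t; rewrite [(_ *: M) _]ffunE [(_ *: F) _]ffunE.
case: ifP => _; last by move=> [-> ->]; rewrite !scaler0.
move=> h; rewrite /GRing.scale /= mulrCA -[(d + _)%N]add0n.
by apply: has_topM => //; apply: has_topC.
Qed.

(** The discounted degree and [rise_disc] are additive and multiplicative along a path, so they are
    common to all intermediate states [u] between [s] and [t]; the other [u] contribute nothing. *)
Lemma symbolM d d' M M' F F' :
  has_symbol d M F -> has_symbol d' M' F' -> has_symbol (d + d') (M * M') (F * F').
Proof.
move=> sM sM' s t; rewrite !opmxM; case: ifP => [st|nst].
  rewrite mulr_sumr; apply: has_top_sum => u; have := sM s u; have := sM' u t.
  case: ifP => [ut|_]; last by move=> [-> ->] _; rewrite !mulr0; apply: has_top0.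
  case: ifP => [su|_]; last by move=> _ [-> ->]; rewrite !mul0r mulr0; apply: has_top0.
  move=> h' h; rewrite (rise_discM su ut) (riseD su ut) mulnDr addnACA mulrACA.
  exact: has_topM.
have z u : below s u = false \/ below u t = false.
  by case su: (below s u); [right|left] => //; apply: contraFF nst; apply: below_trans.
split; apply: big1 => u _; have := sM s u; have := sM' u t.
  by case: (z u) => ->; [move=> _ [-> _]; rewrite mul0r | move=> [-> _] _; rewrite mulr0].
by case: (z u) => ->; [move=> _ [_ ->]; rewrite mul0r | move=> [_ ->] _; rewrite mulr0].
Qed.

Lemma symbol_lt d d' M F : (d < d')%N -> has_symbol d M F -> has_symbol d' M 0.
Proof.
move=> dd' sM s t; have := sM s t; rewrite [(0 : B0) _]ffunE mulr0.
case: ifP => _; last by case.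
by apply: has_top_lt; rewrite ltn_add2r.
Qed.

Lemma symbol1 : has_symbol 0 1 1.
Proof.
move=> s t; rewrite !opmx1; case: eqP => [<-|_]; last first.
  by case: ifP => _; rewrite ?mulr0 //; apply: has_top0.
have -> : below s s by apply/forallP => k.
rewrite mulr1 /rise_disc /rise !big1 => [|k _|k _]; rewrite ?subnn ?expr0 //.
by rewrite muln0; apply: has_topC.
Qed.

Lemma symbol_comm d d' M M' F F' :
  has_symbol d M F -> has_symbol d' M' F' -> has_symbol (d + d') (comm M M') (comm F F').
Proof.
move=> sM sM'; rewrite /comm; apply: symbolD; first exact: symbolM.
rewrite -scaleN1r -[X in has_symbol _ _ X]scaleN1r.
have -> : -1 = site_const (-1) by rewrite rmorphN1.
have -> : -1 = (-1)%:MP :> mpol by rewrite rmorphN1.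
by apply: symbolZ; rewrite addnC; apply: symbolM.
Qed.

Lemma symbol_prod (T : Type) (ks : seq T) (d : T -> nat) (M : T -> Bz) (F : T -> B0) :
  (forall x, has_symbol (d x) (M x) (F x)) ->
  has_symbol (\sum_(x <- ks) d x) (\prod_(x <- ks) M x) (\prod_(x <- ks) F x).
Proof.
move=> h; elim/big_rec3: _ => [|x f m dd _ IH]; first exact: symbol1.
exact: symbolM.
Qed.

Lemma symbolX d r M F : has_symbol d M F -> has_symbol (r * d) (M ^+ r) (F ^+ r).
Proof.
move=> h; elim: r => [|r IHr]; first exact: symbol1.
by rewrite !exprS mulSn; apply: symbolM.
Qed.

End Symbols.

(** * The evaluation representations of n_+[t] *)

Section ClassicalOperators.
Variables (N n : nat) (K : comNzRingType) (c : 'I_N -> K).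
Local Notation B0 := (opmx (state0 N n) K).
Implicit Types (s t u : state N n) (k l : 'I_N).

Definition set_site s k (j : nat) : state N n :=
  [ffun l => if l == k then inord j else s l].

Lemma set_site_id s k j : (j <= n)%N -> set_site s k j k = j :> nat.
Proof. by move=> jn; rewrite ffunE eqxx inordK. Qed.

Lemma set_site_neq s k j l : l != k -> set_site s k j l = s l.
Proof. by move=> /negPf lk; rewrite ffunE lk. Qed.

Definition unit_op k (i j : nat) : B0 :=
  [ffun p : state N n * state N n => (p.1 k == i :> nat)%:R * (set_site p.1 k j == p.2)%:R].

(** The action of [E_ij] t^r on the tensor product of the evaluation representations at the points
    [c k]. *)
Definition loop_op (i j r : nat) : B0 := \sum_k c k ^+ r *: unit_op k i j.

Lemma unit_opE k i j s t :
  unit_op k i j (s, t) = (s k == i :> nat)%:R * (set_site s k j == t)%:R.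
Proof. by rewrite ffunE. Qed.

Lemma unit_opM k i j (F : B0) s t :
  (unit_op k i j * F) (s, t) = (s k == i :> nat)%:R * F (set_site s k j, t).
Proof.
rewrite opmxM (bigD1 (set_site s k j)) //= unit_opE eqxx mulr1 big1 ?addr0 // => u /negPf su.
by rewrite unit_opE [_ == u]eq_sym su mulr0 mul0r.
Qed.

Lemma comm_unit_op k l i j : (i < j)%N -> (j < n)%N ->
  comm (unit_op k i j) (unit_op l j j.+1) = if k == l then unit_op k i j.+1 else 0.
Proof.
move=> lij ljn; apply/ffunP=> -[s t]; rewrite /comm opmxD opmxN !unit_opM !unit_opE.
have [<-|kl] := eqVneq k l.
  rewrite unit_opE !set_site_id ?(ltnW ljn) // eqxx.
  have -> : (j.+1 == i) = false by lia.
  have -> : set_site (set_site s k j) k j.+1 = set_site s k j.+1.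
    by apply/ffunP=> p; rewrite !ffunE; case: eqP.
  by rewrite !mul0r mulr0 subr0 mul1r.
have lk : l != k by rewrite eq_sym.
rewrite [RHS]ffunE !set_site_neq //.
have -> : set_site (set_site s k j) l j.+1 = set_site (set_site s l j.+1) k j.
  apply/ffunP=> p; rewrite !ffunE.
  by have [->|] := eqVneq p l; rewrite ?[l == k]eq_sym ?(negPf kl).
by ring.
Qed.

Lemma comm_loop_op i j r : (i < j)%N -> (j < n)%N ->
  comm (loop_op i j r) (loop_op j j.+1 0) = loop_op i j.+1 r.
Proof.
move=> lij ljn; rewrite [LHS]comm_sumZ /=.
rewrite -(pair_bigA _ (fun k l => (c k ^+ r * c l ^+ 0) *: comm (unit_op k i j) (unit_op l j j.+1))) /=.
apply: eq_bigr => k _; rewrite (bigD1 k) //= comm_unit_op // eqxx expr0 mulr1.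
by rewrite big1 ?addr0 // => l /negPf lk; rewrite comm_unit_op // eq_sym lk scaler0.
Qed.

End ClassicalOperators.

Section HopSymbols.
Variables (R : realType) (N n : nat).
Local Notation mpol := {mpoly (CC R)[N]}.
Local Notation site_ring := {poly mpol}.
Local Notation site_const := (polyC \o @mpolyC N (CC R)).
Local Notation Bz := (opmx (state0 N n) site_ring).
Implicit Types (s t u : state N n) (k l : 'I_N).

Definition site_var k : mpol := 'X_k.

(** The shift [i%:R * h] of the spectral parameter and the indicator in the amplitude are constants
    in the grading variable, hence invisible in the top coefficient. *)
Lemma symbol_hop (h : mpol) i r k : (i < n)%N ->
  has_symbol r (spectral (@site_param R N) h%:P k i ^+ r *: hop n (@site_param R N) k i)
    (site_var k ^+ r *: unit_op n mpol k i i.+1).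
Proof.
move=> lin s t; rewrite [(_ *: hop _ _ _ _) _]ffunE [(_ *: unit_op _ _ _ _ _) _]ffunE hopE unit_opE.
have [sk|_] := eqVneq (s k : nat) i; last first.
  by case: ifP => _; rewrite !mul0r ?scaler0 ?mulr0 //; apply: has_top0.
have -> : set_site s k i.+1 = raise s k.
  by apply/ffunP=> l; rewrite !ffunE; case: eqP => // ->; rewrite sk.
have skn : (s k < n)%N by rewrite sk.
have [<-|_] := eqVneq (raise s k) t; last first.
  by case: ifP => _; rewrite !mulr0 ?scaler0 ?mulr0 //; apply: has_top0.
have -> : below s (raise s k) by apply/forallP => l; rewrite raiseE // leq_addr.
have -> : rise s (raise s k) = 1%N.
  rewrite /rise (bigD1 k) //= raise_id // subSnn big1 // => l lk.
  by rewrite raise_neq // subnn.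
have -> : rise_disc R s (raise s k) = site_disc R k.
  rewrite /rise_disc (bigD1 k) //= raise_id // subSnn expr1 big1 ?mulr1 // => l lk.
  by rewrite raise_neq // subnn expr0.
rewrite !mulr1 !mul1r /GRing.scale /= mulr1 [_ * site_var k ^+ r]mulrC muln1.
apply: has_topM.
  rewrite -[X in has_top X]mul1n; apply: has_topX; rewrite -[site_var k]addr0 /spectral.
  apply: has_topD.
    by split; rewrite ?coefZ ?coefX ?mulr1 // (leq_trans (size_scale_leq _ _)) ?size_polyX.
  apply: (@has_top_lt _ 0 1 _ (i%:R * h)) => //.
  by rewrite -polyC_natr -polyCM; apply: has_topC.
have -> : N.-1 = #|[pred l : 'I_N | l != k]|.
  by have := cardC1 k; rewrite card_ord => <-; apply: eq_card => l; rewrite !inE.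
apply: has_top_prod => l _; rewrite -[X in has_top _ _ X]subr0.
apply: has_topD; last first.
  rewrite oppr0; apply: (@has_top_lt _ 0 1 _ (- (s l == i.+1 :> nat)%:R)) => //.
  by rewrite -polyC_natr -polyCN; apply: has_topC.
rewrite /site_param -scalerBl; split; last by rewrite coefZ coefX mulr1.
by rewrite (leq_trans (size_scale_leq _ _)) ?size_polyX.
Qed.

Lemma symbol_site_e i r : (i < n)%N ->
  has_symbol r (site_e R N n i r : Bz) (loop_op n site_var i i.+1 r).
Proof. by move=> lin; apply: symbol_sum => k; apply: symbol_hop. Qed.

End HopSymbols.

Lemma e_root_simple (R : realType) (A : algType (CC R)) (e : nat -> nat -> A) i r :
  e_root e i i r = e i r.
Proof. by rewrite /e_root subnn. Qed.

Lemma e_rootS (R : realType) (A : algType (CC R)) (e : nat -> nat -> A) i j r : (i <= j)%N ->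
  e_root e i j.+1 r = comm (e_root e i j r) (e j.+1 0).
Proof.
move=> ij; rewrite /e_root subSn // -[(j - i).+1]addn1 iotaD foldl_cat /=.
by rewrite addSn subnKC.
Qed.

Lemma e_root_morph (R : realType) (n : nat) (A B : algType (CC R)) (e : nat -> nat -> A)
  (e' : nat -> nat -> B) (f : {lrmorphism A -> B}) :
  (forall i r, inI n i -> f (e i r) = e' i r) ->
  forall i j r, is_root n (i, j) -> f (e_root e i j r) = e_root e' i j r.
Proof.
move=> fe i j r /andP[/andP[/= i1 ij] jn]; elim: j ij jn => [|j IHj]; first by lia.
rewrite leq_eqVlt => /predU1P[->|ij] jn.
  by rewrite !e_root_simple fe // /inI jn.
rewrite !e_rootS // /comm rmorphB /= !rmorphM /= fe ?IHj //; first exact: ltnW.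
Qed.

Lemma symbol_e_root (R : realType) (N n i j r : nat) : is_root n (i, j) ->
  has_symbol r (e_root (site_e R N n) i j r : opmx _ _) (loop_op n (@site_var R N) i j.+1 r).
Proof.
move=> /andP[/andP[/= i1 ij] jn]; elim: j ij jn => [|j IHj]; first by lia.
rewrite leq_eqVlt => /predU1P[->|ij] jn.
  by rewrite e_root_simple; apply: symbol_site_e; apply: inI_lt; rewrite /inI jn.
have jn' : (j.+1 < n)%N by apply: inI_lt; rewrite /inI jn.
rewrite e_rootS // -comm_loop_op // -[X in has_symbol X]addn0.
by apply: symbol_comm; [apply: IHj => //; exact: ltnW | exact: symbol_site_e].
Qed.

(** * Matrix coefficients of ordered products in the classical representation *)

Section DividedLoopOperators.
Variables (R : realType) (N n : nat).
Local Notation mpol := {mpoly (CC R)[N]}.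
Local Notation B0 := (opmx (state0 N n) mpol).
Implicit Types (s t u : state N n) (k l : 'I_N).

Definition moved s t : {set 'I_N} := [set k | s k != t k].

Definition moved_mon r s t : 'X_{1..N} := [multinom (if s k != t k then r else 0%N) | k < N].

Definition divided_loop (i j r m : nat) : B0 :=
  [ffun p : state N n * state N n =>
     ((#|moved p.1 p.2| == m) &&
      [forall k in moved p.1 p.2, (p.1 k == i :> nat) && (p.2 k == j :> nat)])%:R
     * 'X_[moved_mon r p.1 p.2]].

Lemma divided_loopE i j r m s t :
  divided_loop i j r m (s, t) = ((#|moved s t| == m) &&
      [forall k in moved s t, (s k == i :> nat) && (t k == j :> nat)])%:R * 'X_[moved_mon r s t].
Proof. by rewrite ffunE. Qed.

Lemma moved_set_site s t k j : (j <= n)%N -> t k = j :> nat -> moved (set_site s k j) t = moved s t :\ k.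
Proof.
move=> jn tk; apply/setP => l; rewrite !inE.
have [->|lk] := eqVneq l k; last by rewrite set_site_neq.
by apply/negbTE/negPn/eqP/val_inj; rewrite /= set_site_id.
Qed.

(** Since [i < j] no particle jumps twice. Any of the [m.+1] moved particles may go first, and all
    choices contribute the same monomial. *)
Lemma loop_op_divided i j r m : (i < j)%N -> (j <= n)%N ->
  loop_op n (@site_var R N) i j r * divided_loop i j r m = divided_loop i j r m.+1 *+ m.+1.
Proof.
move=> lij ljn; apply/ffunP => -[s t].
rewrite opmxMn mulr_suml sum_ffunE.
transitivity (\sum_(k in moved s t) divided_loop i j r m.+1 (s, t)); last first.
  rewrite sumr_const divided_loopE; case: eqP => [->//|_].
  by rewrite !mul0r !mul0rn.
rewrite [RHS]big_mkcond; apply: eq_bigr => k _.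
rewrite -scalerAl ffunE unit_opM /GRing.scale /= !divided_loopE.
have [sk|sk] := eqVneq (s k : nat) i; last first.
  rewrite mul0r mulr0; case: ifP => // km.
  rewrite [in RHS](_ : [forall l in _, _] = false) ?andbF ?mul0r //.
  by apply/negbTE/forall_inPn; exists k => //; rewrite (negPf sk).
rewrite mul1r; have [tk|tk] := eqVneq (t k : nat) j; last first.
  have km : k \in moved (set_site s k j) t.
    by rewrite inE; apply: contraNneq tk => <-; rewrite set_site_id.
  rewrite (_ : [forall l in moved (set_site s k j) t, _] = false).
    rewrite andbF mul0r mulr0; case: ifP => // km'.
    rewrite [in RHS](_ : [forall l in _, _] = false) ?andbF ?mul0r //.
    by apply/negbTE/forall_inPn; exists k; rewrite // (negPf tk) andbF.
  by apply/negbTE/forall_inPn; exists k; rewrite // (negPf tk) andbF.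
have km : k \in moved s t.
  by rewrite inE; apply/negP => /eqP st; move: lij; rewrite -sk -tk st ltnn.
rewrite km moved_set_site // (cardsD1 k (moved s t)) km add1n eqSS.
have -> : [forall l in moved s t :\ k, (set_site s k j l == i :> nat) && (t l == j :> nat)]
  = [forall l in moved s t, (s l == i :> nat) && (t l == j :> nat)].
  apply/forall_inP/forall_inP => h l.
    have [-> _|lk lm] := eqVneq l k; first by rewrite sk tk !eqxx.
    by have := h l; rewrite !inE lk set_site_neq //; apply; rewrite inE in lm.
  by rewrite !inE => /andP[lk lm]; rewrite set_site_neq //; apply: h; rewrite inE.
rewrite mulrCA; congr (_ * _).
rewrite /site_var mpolyXn -mpolyXD; congr 'X_[_]; apply/mnmP => l.
rewrite mnmDE mulmnE mnm1E !mnmE.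
have [<-|lk] := eqVneq k l.
  move: km; rewrite inE => ->; rewrite (_ : set_site s k j k = t k) ?eqxx ?mul1n ?addn0 //.
  by apply/val_inj; rewrite /= set_site_id.
by rewrite mul0n add0n set_site_neq // eq_sym.
Qed.

Lemma divided_loop0 i j r : divided_loop i j r 0 = 1.
Proof.
apply/ffunP => -[s t]; rewrite opmx1 divided_loopE cards_eq0.
case: (eqVneq s t) => [<-|st].
  have -> : moved s s = set0 by apply/setP => k; rewrite !inE eqxx.
  rewrite eqxx (_ : [forall k in _, _] = true); last by apply/forall_inP => k; rewrite inE.
  rewrite mul1r (_ : moved_mon r s s = 0%MM) ?mpolyX0 //.
  by apply/mnmP => k; rewrite !mnmE eqxx.
rewrite (_ : moved s t == set0 = false) ?mul0r //.
apply: contraNF st => /eqP m0; apply/eqP/ffunP => k; apply/eqP.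
by have := in_set0 k; rewrite -m0 inE => /negbFE.
Qed.

Lemma loop_opX i j r m : (i < j)%N -> (j <= n)%N ->
  loop_op n (@site_var R N) i j r ^+ m = divided_loop i j r m *+ m`!.
Proof.
move=> lij ljn; elim: m => [|m IHm]; first by rewrite divided_loop0.
by rewrite exprS IHm mulrnAr loop_op_divided // -mulrnA factS.
Qed.

Variables (T : eqType) (key : T -> nat * nat * nat) (h : T -> nat).
Hypothesis keyI : injective key.

Definition divided_key (x : T) : B0 :=
  divided_loop (key x).1.1 (key x).1.2 (key x).2 (h x).

Definition site_key s t (m : 'X_{1..N}) k : nat * nat * nat := (s k : nat, t k : nat, m k).

(* The coefficient of [m] selects one factor [key x] for each particle, from its two end points
   and its exponent in [m]; it is nonzero when each factor is selected with the right multiplicity. *)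
Definition key_count (ks : seq T) s t (m : 'X_{1..N}) : bool :=
  [forall k, if s k == t k then m k == 0%N else site_key s t m k \in map key ks]
  && all (fun x => #|[set k in moved s t | site_key s t m k == key x]| == h x) ks.

Lemma moved_sub s u t : moved s t \subset moved s u :|: moved u t.
Proof.
apply/subsetP => k; rewrite !inE => st; rewrite -negb_and; apply: contra st.
by case/andP => /eqP -> /eqP ->.
Qed.

Lemma divided_prod_small ks s t : (\sum_(x <- ks) h x < #|moved s t|)%N ->
  (\prod_(x <- ks) divided_key x) (s, t) = 0.
Proof.
elim: ks s t => [|x ks IH] s t; rewrite ?big_nil ?big_cons.
  rewrite opmx1; case: eqP => // ->.
  have -> : moved t t = set0 by apply/setP => k; rewrite !inE eqxx.
  by rewrite cards0.
move=> lt; rewrite opmxM big1 // => u _; rewrite {1}/divided_key divided_loopE.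
case: eqP => [cx|_]; last by rewrite !mul0r.
rewrite IH ?mulr0 //.
have := subset_leq_card (moved_sub s u t); rewrite cardsU cx; lia.
Qed.

Lemma movedP s t k : (k \in moved s t) = (s k != t k).
Proof. by rewrite inE. Qed.

Section KeyCountCons.
Variables (x : T) (ks : seq T) (s u t : state N n) (m : 'X_{1..N}).
Hypothesis xks : x \notin ks.
Hypothesis card_st : #|moved s t| = (h x + \sum_(y <- ks) h y)%N.
Let r := (key x).2.

(* In a path [s -> u -> t] contributing to the coefficient of [m], each site moves exactly once,
   either in the first step or in the second. *)
Let site_split k : Prop :=
  [\/ [/\ s k != u k, u k = t k, m k = r, s k = (key x).1.1 :> nat & t k = (key x).1.2 :> nat],
      [/\ s k = u k, s k != t k & site_key s t m k \in map key ks]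
    | [/\ s k = u k, u k = t k & m k = 0%N]].

(** The condition for a path through [u] to contribute 1 to the coefficient of [m]: the factor of
    [x] performs the first step, and the other factors account for what it leaves of [m]. *)
Definition first_step := [&& #|moved s u| == h x,
  [forall k in moved s u, (s k == (key x).1.1 :> nat) && (u k == (key x).1.2 :> nat)],
  #|moved u t| == \sum_(y <- ks) h y, (moved_mon r s u <= m)%MM
  & key_count ks u t (m - moved_mon r s u)%MM].

(** The only candidate for [u]: particles that [m] assigns to [x] have arrived, all others have not
    started. *)
Definition waypoint : state N n :=
  [ffun k => if (s k != t k) && (site_key s t m k == key x) then t k else s k].

Lemma site_key_in k : s k = (key x).1.1 :> nat -> t k = (key x).1.2 :> nat -> m k = r ->
  site_key s t m k = key x.
Proof. by rewrite /site_key /r => -> -> ->; case: (key x) => -[]. Qed.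

Lemma site_key_notin k : site_key s t m k \in map key ks -> site_key s t m k == key x = false.
Proof. by move=> kin; apply: contraNF xks => /eqP E; rewrite E mem_map in kin. Qed.

Lemma first_step_split : first_step -> forall k, site_split k.
Proof.
case/and5P => /eqP cA /forall_inP hA /eqP cB /mnm_lepP hm /andP[/forallP K1 _] k.
(* The cardinalities leave no room for a particle that moves in both steps. *)
have disj : moved s u :&: moved u t = set0.
  apply/eqP; rewrite -cards_eq0; have := subset_leq_card (moved_sub s u t).
  have := subset_leq_card (subsetIl (moved s u) (moved u t)); rewrite cardsU cA cB card_st.
  move: #|_ :&: _| (\sum_(y <- ks) h y)%N => p q; lia.
have dk : (s k == u k) || (u k == t k).
  by have := in_set0 k; rewrite -disj inE !movedP => /negbT; rewrite negb_and !negbK.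
have := K1 k; have := hm k; rewrite mnmBE !mnmE.
have [suk|suk] := eqVneq (s k) (u k); last first.
  move: dk; rewrite (negPf suk) /= => utk rm; rewrite utk => /eqP m0.
  have := hA k; rewrite movedP => /(_ suk) /andP[/eqP si /eqP uj].
  by apply: Or31; split=> //; [apply/eqP | lia | rewrite -(eqP utk)].
move=> _; have [utk|utk] := eqVneq (u k) (t k).
  by rewrite subn0 => /eqP m0; apply: Or33.
by rewrite /site_key mnmBE mnmE suk eqxx subn0 => kin; apply: Or32; split; rewrite // ?/site_key suk.
Qed.

Lemma waypoint_split : u = waypoint -> key_count (x :: ks) s t m -> forall k, site_split k.
Proof.
move=> uE /andP[/forallP K1 _] k; have := K1 k; rewrite /site_split.
have -> : u k = if (s k != t k) && (site_key s t m k == key x) then t k else s k.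
  by rewrite uE ffunE.
have [stk|stk] := eqVneq (s k) (t k); first by move/eqP => m0; apply: Or33.
rewrite inE /=; have [kx _|kx kin] := eqVneq (site_key s t m k) (key x); last exact: Or32.
by apply: Or31; split; rewrite // /r -kx.
Qed.

Lemma split_first_step : (forall k, site_split k) ->
  first_step = (u == waypoint) && key_count (x :: ks) s t m.
Proof.
move=> spl.
have -> : u == waypoint.
  apply/eqP/ffunP => k; rewrite ffunE; case: (spl k) => -[].
  - by move=> su ut mr si tj; rewrite site_key_in // eqxx -ut su.
  - by move=> su st kin; rewrite site_key_notin // andbF.
  - by move=> su ut _; rewrite su ut eqxx.
have mA : moved s u = [set k in moved s t | site_key s t m k == key x].
  apply/setP => k; rewrite !inE; case: (spl k) => -[].
  - by move=> su ut mr si tj; rewrite site_key_in // eqxx -ut su.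
  - by move=> <- st kin; rewrite site_key_notin // andbF eqxx.
  - by move=> <- <- _; rewrite eqxx.
have mB : moved u t = moved s t :\: moved s u.
  apply/setP => k; rewrite !inE; case: (spl k) => -[].
  - by move=> su -> _ _ _; rewrite eqxx andNb.
  - by move=> <- st _; rewrite eqxx st.
  - by move=> <- <- _; rewrite eqxx.
have keyE k : u k != t k -> site_key u t (m - moved_mon r s u)%MM k = site_key s t m k.
  rewrite /site_key mnmBE mnmE; case: (spl k) => -[].
  - by move=> _ ->; rewrite eqxx.
  - by move=> <-; rewrite eqxx subn0.
  - by move=> _ ->; rewrite eqxx.
rewrite /first_step (_ : [forall k in _, _] = true); last first.
  apply/forall_inP => k; rewrite movedP; case: (spl k) => -[].
  - by move=> _ -> _ -> ->; rewrite !eqxx.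
  - by move=> ->; rewrite eqxx.
  - by move=> ->; rewrite eqxx.
rewrite (_ : (moved_mon r s u <= m)%MM); last first.
  apply/mnm_lepP => k; rewrite mnmE; case: (spl k) => -[].
  - by move=> -> _ ->.
  - by move=> ->; rewrite eqxx.
  - by move=> ->; rewrite eqxx.
rewrite /key_count (_ : [forall k, _] = true); last first.
  apply/forallP => k; case: (eqVneq (u k) (t k)) => [ut|ut].
    rewrite mnmBE mnmE; case: (spl k) => -[].
    - by move=> -> _ -> _ _; rewrite subnn.
    - by move=> ->; rewrite ut eqxx.
    - by move=> _ _ ->.
  rewrite keyE //; case: (spl k) => -[].
  - by move=> _ utk; rewrite utk eqxx in ut.
  - by [].
  - by move=> _ utk; rewrite utk eqxx in ut.
rewrite [in RHS](_ : [forall k, _] = true); last first.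
  apply/forallP => k; case: (spl k) => -[].
  - by move=> su ut mr si tj; rewrite site_key_in // -ut (negPf su) inE eqxx.
  - by move=> _ /negPf -> kin; rewrite inE kin orbT.
  - by move=> -> -> ->; rewrite eqxx.
rewrite /= -mA; case: (eqVneq #|moved s u| (h x)) => //= cA.
rewrite (_ : #|moved u t| == _); last first.
  rewrite mB cardsD (setIidPr _); first by rewrite card_st cA addKn.
  by rewrite mA; apply/subsetP => k; rewrite inE => /andP[].
apply: eq_in_all => y yks; congr (_ == _); apply: eq_card => k; rewrite !inE.
case: (spl k) => -[].
- move=> su ut mr si tj; rewrite (site_key_in si tj mr) ut eqxx /= -ut su /=.
  by apply/esym/negbTE; apply: contraNneq xks => /keyI ->.
- by move=> su st kin; rewrite -su st keyE // -su.
- by move=> -> ->; rewrite eqxx.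
Qed.

(** Each side forces [site_split] at every site, and under [site_split] the two sides agree. The sum
    over intermediate states thus collapses to one term. *)
Lemma first_stepE : first_step = (u == waypoint) && key_count (x :: ks) s t m.
Proof.
apply/idP/idP => [fs|/andP[uw kc]].
  by rewrite -split_first_step //; apply: first_step_split.
by rewrite split_first_step ?uw ?kc //; apply: waypoint_split => //; apply/eqP.
Qed.

End KeyCountCons.

End DividedLoopOperators.

Lemma mcoeffXM (R : nzRingType) (N : nat) (p : {mpoly R[N]}) (a m : 'X_{1..N}) :
  ('X_[a] * p)@_m = if (a <= m)%MM then p@_(m - a)%MM else 0.
Proof.
case: ifP => am.
  by rewrite -{1}(submK am) addmC -commr_mpolyX mcoeffMX.
rewrite mcoeffM big1 // => -[k1 k2] /= /eqP mE; rewrite mcoeffX.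
have [aE|_] := eqVneq a k1; last by rewrite mul0r.
suff: (a <= m)%MM by rewrite am.
by rewrite mE -aE lem_addr.
Qed.

Section DividedProductCoefficients.
Variables (R : realType) (N n : nat).
Variables (T : eqType) (key : T -> nat * nat * nat) (h : T -> nat).
Hypothesis keyI : injective key.
Implicit Types (s t u : state N n).

Lemma divided_prod_coef ks s t m : uniq ks -> #|moved s t| = (\sum_(x <- ks) h x)%N ->
  ((\prod_(x <- ks) divided_key R N n key h x) (s, t))@_m = (key_count key h ks s t m)%:R.
Proof.
elim: ks s t m => [|x ks IH] s t m.
  move=> _; rewrite !big_nil opmx1 => /eqP; rewrite cards_eq0 => /eqP m0.
  have -> : s = t.
    by apply/ffunP => k; apply/eqP; have := in_set0 k; rewrite -m0 inE => /negbFE.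
  rewrite eqxx mcoeff1 /key_count /= andbT; congr (nat_of_bool _)%:R.
  apply/eqP/forallP => [-> k|h0]; first by rewrite eqxx mnmE.
  by apply/mnmP => k; have := h0 k; rewrite eqxx mnmE => /eqP.
rewrite !big_cons => /andP[xks uks] cst.
rewrite opmxM raddf_sum /=.
rewrite (eq_bigr (fun u => (first_step key h x ks s u t m)%:R)) => [|u _].
  under eq_bigr do rewrite first_stepE //.
  rewrite (bigD1 (waypoint key x s t m)) //= eqxx /= big1 ?addr0 // => u /negPf ->.
  by [].
rewrite {1}/divided_key divided_loopE /first_step.
case: eqP => [cA|_]; last by rewrite !mul0r mcoeff0.
case: [forall k in _, _]; last by rewrite !mul0r mcoeff0.
(* If more particles remain than the other factors can move, their product vanishes; fewer cannot
   remain, because the first step moves only [h x] of them. *)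
rewrite mul1r /=; have [lt|] := ltnP (\sum_(y <- ks) h y) #|moved u t|.
  by rewrite divided_prod_small // mulr0 mcoeff0 gtn_eqF.
rewrite leq_eqVlt => /predU1P[cB|lt]; last first.
  have := subset_leq_card (moved_sub s u t); rewrite cardsU cA cst.
  move: (#|_ :&: _|) lt => q; lia.
rewrite cB eqxx /= mcoeffXM; case: ifP => // _.
by rewrite IH.
Qed.

End DividedProductCoefficients.

(** * Coordinates with respect to the ordered monomials *)

Section DiscriminantDivision.
Variables (R : realType) (N : nat).
Local Notation mpol := {mpoly (CC R)[N]}.
Implicit Types (p q : mpol).

Definition dyadic_coefs p : Prop := forall m, p@_m \in @dyadic_pred R.

Definition dyadic_divisor p : Prop := forall q, dyadic_coefs (p * q) -> dyadic_coefs q.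

Lemma dyadic_divisor1 : dyadic_divisor 1.
Proof. by move=> q; rewrite mul1r. Qed.

Lemma dyadic_divisorM p p' : dyadic_divisor p -> dyadic_divisor p' -> dyadic_divisor (p * p').
Proof. by move=> h h' q; rewrite -mulrA => /h/h'. Qed.

(** The coefficient of [m + U_(k)] in the product is [q@_m] minus a coefficient of [q] with a
    smaller exponent at [l]. Induction on that exponent solves for [q@_m] without dividing by any
    scalar. *)
Lemma dyadic_divisor_subX (k l : 'I_N) : l != k -> dyadic_divisor ('X_k - 'X_l).
Proof.
move=> lk q dq m; elim/ltn_ind: {m}(m l) {-2}m (erefl (m l)) => d IH m md.
have := dq (m + U_(k))%MM; rewrite mulrBl mcoeffB !mcoeffXM lem_addl addmK.
case: ifP => lm; last by rewrite subr0.
have ml : (0 < m l)%N.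
  by move/mnm_lepP: lm => /(_ l); rewrite mnmDE !mnm1E eqxx eq_sym (negPf lk) addn0.
move=> dm; rewrite -[q@_m](subrK q@_(m + U_(k) - U_(l))%MM).
apply: rpredD => //; apply: (IH (m l).-1); first by rewrite -md prednK.
by rewrite mnmBE mnmDE !mnm1E eqxx eq_sym (negPf lk) addn0 subn1.
Qed.

Lemma rise_disc_divisor n (s t : state N n) : dyadic_divisor (rise_disc R s t).
Proof.
apply: (big_ind dyadic_divisor); [exact: dyadic_divisor1 | exact: dyadic_divisorM |].
move=> k _; elim: (t k - s k)%N => [|d IHd]; first exact: dyadic_divisor1.
rewrite exprS; apply: dyadic_divisorM => //.
apply: (big_ind dyadic_divisor); [exact: dyadic_divisor1 | exact: dyadic_divisorM |].
by move=> l lk; apply: dyadic_divisor_subX.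
Qed.

End DiscriminantDivision.

Definition rkey_triple n (x : rkey n) : nat * nat * nat :=
  ((val x.1).1, (val x.1).2.+1, x.2).

Lemma rkey_triple_inj n : injective (@rkey_triple n).
Proof.
by case=> [[[i j] ?] r] [[[i' j'] ?] r'] [/= ii jj ->]; congr pair; apply: val_inj; rewrite /= ii jj.
Qed.

Lemma count_flatten_nseq (T : eqType) (h : T -> nat) (s : seq T) x : uniq s ->
  count_mem x (flatten [seq nseq (h y) y | y <- s]) = if x \in s then h x else 0%N.
Proof.
elim: s => //= y s IHs /andP[ys us]; rewrite count_cat IHs // count_nseq /= inE.
have [<-|yx] := eqVneq y x; first by rewrite (negPf ys) mul1n addn0.
by rewrite mul0n.
Qed.

Lemma card_tnth_count (T : eqType) (s : seq T) x :
  #|[set k | tnth (in_tuple s) k == x]| = count_mem x s.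
Proof.
rewrite -sum1_card -sum1_count [RHS](big_tnth _ _ s) /=.
by apply: eq_bigl => k; rewrite inE.
Qed.

(** * The matrix entry and the monomial that detect a given [h0] *)

Section SiteStates.
Variables (R : realType) (n : nat).
Implicit Types (h : fsupp_fun n).

Definition fs_deg h : nat := \sum_(x <- finsupp h) h x * x.2.
Definition fs_len h : nat := \sum_(x <- finsupp h) h x.
Definition fs_list h : seq (rkey n) := flatten [seq nseq (h x) x | x <- finsupp h].
Definition fs_keys h : seq (rkey n) := sort (@rkey_le n) (finsupp h).

Lemma fs_list_size h : size (fs_list h) = fs_len h.
Proof.
rewrite size_flatten /shape -map_comp sumnE big_map; apply: eq_bigr => x _ /=.
exact: size_nseq.
Qed.

Lemma fs_list_count h x : count_mem x (fs_list h) = h x.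
Proof. by rewrite count_flatten_nseq ?fset_uniq //; case: finsuppP. Qed.

Lemma fs_keys_uniq h : uniq (fs_keys h).
Proof. by rewrite sort_uniq fset_uniq. Qed.

Lemma mem_fs_keys h x : (x \in fs_keys h) = (x \in finsupp h).
Proof. exact: mem_sort. Qed.

Lemma sum_fs_keys h (F : rkey n -> nat) :
  (\sum_(x <- fs_keys h) F x = \sum_(x <- finsupp h) F x)%N.
Proof. by apply: perm_big; rewrite perm_sort. Qed.

Definition fs_symbol N h : opmx (state0 N n) {mpoly (CC R)[N]} :=
  \prod_(x <- fs_keys h) divided_key R N n (@rkey_triple n) h x.

Section Sites.
Variable h0 : fsupp_fun n.
Let N := size (fs_list h0).
Let at_site (k : 'I_N) : rkey n := tnth (in_tuple (fs_list h0)) k.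

Definition low_state : state N n := [ffun k => inord (rkey_triple (at_site k)).1.1].
Definition high_state : state N n := [ffun k => inord (rkey_triple (at_site k)).1.2].
Definition loop_mon : 'X_{1..N} := [multinom (at_site k).2 | k < N].

Lemma proot_bounds (b : proot n) : ((val b).1 <= (val b).2)%N /\ ((val b).2 < n)%N.
Proof.
case: b => [[i j]] /= /andP[/andP[/= i1 ij] jn]; split=> //.
by apply: inI_lt; rewrite /inI jn andbT (leq_trans i1).
Qed.

Lemma low_stateE k : low_state k = (val (at_site k).1).1 :> nat.
Proof.
have [ij jn] := proot_bounds (at_site k).1.
by rewrite ffunE inordK // ltnS (leq_trans ij) // ltnW.
Qed.

Lemma high_stateE k : high_state k = (val (at_site k).1).2.+1 :> nat.
Proof. by have [ij jn] := proot_bounds (at_site k).1; rewrite ffunE inordK. Qed.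

Lemma low_lt_high k : (low_state k < high_state k)%N.
Proof. by have [ij _] := proot_bounds (at_site k).1; rewrite low_stateE high_stateE ltnS. Qed.

Lemma moved_low_high : moved low_state high_state = setT.
Proof.
by apply/setP => k; rewrite !inE; apply/negP => /eqP E; have := low_lt_high k; rewrite E ltnn.
Qed.

Lemma site_key_low_high k :
  site_key low_state high_state loop_mon k = rkey_triple (at_site k).
Proof. by rewrite /site_key low_stateE high_stateE mnmE. Qed.

(** The multiplicities give [h = h0] on the support of [h]; the condition on each site puts the
    support of [h0] inside that of [h]. *)
Lemma key_count_low_high h :
  key_count (@rkey_triple n) h (fs_keys h) low_state high_state loop_mon = (h == h0).
Proof.
have cE x : #|[set k in moved low_state high_state |
    site_key low_state high_state loop_mon k == rkey_triple x]| = h0 x.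
  rewrite -fs_list_count -card_tnth_count; apply: eq_card => k.
  by rewrite moved_low_high !inE site_key_low_high (inj_eq (@rkey_triple_inj n)).
have nE k : (low_state k == high_state k) = false.
  by apply/negbTE; have := in_setT k; rewrite -moved_low_high inE.
apply/andP/eqP => [[/forallP K1 /allP K2]|->].
  apply/fsfunP => x; case: finsuppP => xh; last first.
    by have := K2 x; rewrite mem_fs_keys xh cE => /(_ isT) /eqP.
  apply/esym/eqP; rewrite -leqn0 leqNgt; apply: contra xh.
  rewrite -fs_list_count -has_count => /hasP[y yin /eqP yx].
  have /tnthP[k yE] : y \in in_tuple (fs_list h0) by [].
  have := K1 k; rewrite nE site_key_low_high (mem_map (@rkey_triple_inj n)) mem_fs_keys.
  by rewrite /at_site -yE yx.
split.
  apply/forallP => k; rewrite nE site_key_low_high (mem_map (@rkey_triple_inj n)) mem_fs_keys.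
  rewrite mem_finsupp -fs_list_count -lt0n -has_count has_pred1; exact: mem_tnth.
by apply/allP => x _; rewrite cE.
Qed.

Lemma fs_symbol_coef h : (fs_len h <= fs_len h0)%N ->
  ((fs_symbol N h) (low_state, high_state))@_loop_mon = (h == h0)%:R.
Proof.
have cm : #|moved low_state high_state| = fs_len h0.
  by rewrite moved_low_high cardsT card_ord /N fs_list_size.
rewrite leq_eqVlt => /predU1P[lE|lt].
  rewrite divided_prod_coef ?fs_keys_uniq ?key_count_low_high //; first exact: rkey_triple_inj.
  by rewrite cm sum_fs_keys -lE.
rewrite divided_prod_small ?mcoeff0; last by rewrite cm sum_fs_keys.
by case: eqP => // hE; rewrite hE ltnn in lt.
Qed.

End Sites.

End SiteStates.

(** * Integrality of coordinates *)

Section LeadingTerm.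
Variables (R : realType) (n : nat) (A : algType (CC R)) (e : nat -> nat -> A).
Local Notation site_const N := (polyC \o @mpolyC N (CC R)).
Local Notation Bz N := (opmx (state0 N n) {poly {mpoly (CC R)[N]}}).
Local Notation RB N := (restr_scalars (site_const N) (Bz N)).
Implicit Types (h : fsupp_fun n).

Hypothesis yang : is_Yplus n e.

Lemma particle_morphism N :
  exists f : {lrmorphism A -> RB N}, forall i r, inI n i -> f (e i r) = site_e R N n i r.
Proof. by case: yang => _ /(_ (RB N) _ (site_yangian R N n))[f [fe _]]; exists f. Qed.

Lemma symbol_divpow N (x : rkey n) m :
  has_symbol (m * x.2) (divpow (e_root (site_e R N n) (val x.1).1 (val x.1).2 x.2) m : Bz N)
    (divided_loop R N n (rkey_triple x).1.1 (rkey_triple x).1.2 (rkey_triple x).2 m).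
Proof.
case: x => [[[i j] xr] r]; have [/= ij jn] := proot_bounds (exist _ (i, j) xr).
have s1 := @symbol_e_root R N n i j r xr.
have s2 := symbolZ (m`!%:R^-1) (symbolX m s1).
rewrite loop_opX // in s2.
rewrite -scalerMnr scalerMnl in s2.
have E : (m`!%:R^-1)%:MP_[N] *+ m`! = 1 :> {mpoly (CC R)[N]}.
  by rewrite -(raddfMn (@mpolyC N (CC R))) /= -[_^-1 *+ _]mulr_natr mulVf // pnatr_eq0 -lt0n fact_gt0.
by rewrite E scale1r in s2.
Qed.

Lemma morph_divpow (B : algType (CC R)) (f : {lrmorphism A -> B}) x m :
  f (divpow x m) = divpow (f x) m.
Proof. by rewrite /divpow linearZ /= rmorphXn. Qed.

Lemma symbol_Eh N (f : {lrmorphism A -> RB N}) h :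
  (forall i r, inI n i -> f (e i r) = site_e R N n i r) ->
  has_symbol (fs_deg h) (f (Eh e h) : Bz N) (fs_symbol R N h).
Proof.
move=> fe; rewrite /fs_deg -sum_fs_keys /Eh rmorph_prod.
rewrite (eq_bigr (fun x => divpow (e_root (site_e R N n) (val x.1).1 (val x.1).2 x.2) (h x)));
  last first.
  move=> x _; rewrite [LHS](morph_divpow f) (e_root_morph fe) //.
  by rewrite -surjective_pairing; apply: valP.
by apply: symbol_prod => x; apply: symbol_divpow.
Qed.

Lemma leading_dyadic (s : seq (fsupp_fun n)) (c : fsupp_fun n -> CC R) h0 :
  uniq s -> h0 \in s ->
  (forall h, h \in s -> (fs_deg h < fs_deg h0)%N \/
     (fs_deg h = fs_deg h0 /\ (fs_len h <= fs_len h0)%N)) ->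
  Ybold n e (\sum_(h <- s) c h *: Eh e h) -> dyadic (c h0).
Proof.
move=> us h0s hmax Yb.
pose N := size (fs_list h0).
have [f fe] := particle_morphism N.
(* Monomials of smaller loop degree have symbol 0 in degree [fs_deg h0]. *)
pose F h := if fs_deg h == fs_deg h0 then fs_symbol R N h else 0.
have sym : has_symbol (fs_deg h0) (f (\sum_(h <- s) c h *: Eh e h) : Bz N)
    (\sum_(h <- s) (c h)%:MP *: F h).
  rewrite raddf_sum /= big_seq [X in has_symbol _ _ X]big_seq.
  elim/big_rec2: _ => [|h x y hs IH]; first exact: symbol0.
  apply: symbolD => //; rewrite linearZ /=; apply: symbolZ.
  have := symbol_Eh h fe; rewrite /F.
  have [lt|[-> _]] := hmax h hs; last by rewrite eqxx.
  by rewrite ltn_eqF //; apply: symbol_lt.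
have := sym (low_state h0) (high_state h0).
have -> : below (low_state h0) (high_state h0).
  by apply/forallP => k; apply/ltnW/low_lt_high.
case=> _ top.
have int := Ybold_int fe Yb (low_state h0, high_state h0).
(* The top coefficient is known to be dyadic only after multiplication by [rise_disc], which then
   has to be divided out. *)
have dc : dyadic_coefs ((\sum_(h <- s) (c h)%:MP *: F h) (low_state h0, high_state h0)).
  by apply: (@rise_disc_divisor _ _ _ (low_state h0) (high_state h0)) => m;
     rewrite -top; move/site_intP: int.
have := dc (loop_mon h0).
have ev (x : 'X_{1..N}) : ((\sum_(h <- s) (c h)%:MP *: F h) (low_state h0, high_state h0))@_x
  = \sum_(h <- s) c h * (F h (low_state h0, high_state h0))@_x.
  elim: s {us h0s hmax Yb sym top int dc} => [|h s IH]; first by rewrite !big_nil ffunE mcoeff0.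
  by rewrite !big_cons opmxD mcoeffD IH; congr (_ + _); rewrite ffunE /= mcoeffCM.
rewrite ev (bigD1_seq h0) //= /F eqxx fs_symbol_coef // eqxx mulr1 big_seq_cond big1 ?addr0.
  by move/asboolP.
move=> h /andP[hs hh0]; have [lt|[-> le]] := hmax h hs.
  by rewrite ltn_eqF // ffunE mcoeff0 mulr0.
by rewrite eqxx fs_symbol_coef // (negPf hh0) mulr0.
Qed.

Hypothesis EhY : forall h, Ybold n e (Eh e h).

(** Once the leading coefficient is dyadic, its term lies in the integral form and can be
    subtracted. The coefficients are those of the given expression, with no uniqueness presupposed,
    which is why linear independence can be drawn from the same statement. *)
Lemma Ybold_coefs_dyadic (s : seq (fsupp_fun n)) (c : fsupp_fun n -> CC R) :
  uniq s -> Ybold n e (\sum_(h <- s) c h *: Eh e h) -> forall h, h \in s -> dyadic (c h).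
Proof.
move sz : (size s) => m; elim: m s sz => [|m IH] s; first by move/eqP/nilP => ->.
move=> sz us Yb.
have [h0 h0s hmax] : exists2 h0, h0 \in s & forall h, h \in s -> (fs_deg h < fs_deg h0)%N \/
     (fs_deg h = fs_deg h0 /\ (fs_len h <= fs_len h0)%N).
  elim: s {us Yb IH} m sz => // h s IHs [|m] [sz].
    exists h; rewrite ?mem_head // => h1; rewrite (size0nil sz) inE => /eqP ->; right.
    by split.
  have [h1 h1s H] := IHs _ sz.
  have [le|gt] := boolP ((fs_deg h < fs_deg h1)
      || ((fs_deg h == fs_deg h1) && (fs_len h <= fs_len h1)))%N.
    exists h1 => [|h2]; first by rewrite inE h1s orbT.
    rewrite inE => /predU1P[->|]; last exact: H.
    by case/orP: le => [|/andP[/eqP]]; [left|right].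
  exists h => [|h2]; first exact: mem_head.
  rewrite inE => /predU1P[->|/H]; first by right.
  by move: gt; lia.
have dh0 := leading_dyadic us h0s hmax Yb.
have Yb' : Ybold n e (\sum_(h <- rem h0 s) c h *: Eh e h).
  have -> : \sum_(h <- rem h0 s) c h *: Eh e h
      = \sum_(h <- s) c h *: Eh e h + (- c h0) *: Eh e h0.
    rewrite (perm_big _ (perm_to_rem h0s)) big_cons /= scaleNr [X in X - _]addrC addrK //.
  apply: Yb_add => //; apply: Yb_scale => //.
  suff: - c h0 \in @dyadic_pred R by move/asboolP.
  by rewrite rpredN; apply/asboolP.
move=> h hs; have [->//|hh0] := eqVneq h h0.
apply: (IH (rem h0 s)) => //; first by rewrite size_rem // sz.
  exact: rem_uniq.
by rewrite (rem_filter _ us) mem_filter /= hh0.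
Qed.

End LeadingTerm.

(** * Divided powers of root vectors *)

Section CommutatorCalculus.
Variable A : pzRingType.
Implicit Types x y z : A.

Lemma commC x y : comm x y = - comm y x.
Proof. by rewrite /comm opprB. Qed.

Lemma comm0r x : comm x 0 = 0.
Proof. by rewrite /comm mulr0 mul0r subrr. Qed.

Lemma comm0l x : comm 0 x = 0.
Proof. by rewrite commC comm0r oppr0. Qed.

Lemma commDl x y z : comm (x + y) z = comm x z + comm y z.
Proof. by rewrite /comm mulrDl mulrDr opprD addrACA. Qed.

Lemma commNl x y : comm (- x) y = - comm x y.
Proof. by rewrite /comm mulNr mulrN opprB opprK addrC. Qed.

Lemma commNr x y : comm x (- y) = - comm x y.
Proof. by rewrite commC commNl -commC. Qed.

Lemma commDr x y z : comm x (y + z) = comm x y + comm x z.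
Proof. by rewrite commC commDl opprD -!commC. Qed.

Lemma commMl x y z : comm (x * y) z = x * comm y z + comm x z * y.
Proof. by rewrite /comm mulrBr mulrBl !mulrA subrKA. Qed.

Lemma commMr x y z : comm x (y * z) = comm x y * z + y * comm x z.
Proof. by rewrite /comm mulrBr mulrBl !mulrA subrKA. Qed.

Lemma jacobi x y z : comm x (comm y z) = comm (comm x y) z + comm y (comm x z).
Proof.
rewrite [in LHS]/comm -/(comm y z) -/(comm x _) [comm y z]/comm commDr commNr !commMr.
by rewrite [comm (comm x y) z]/comm [comm y (comm x z)]/comm opprD (addrC (- _)) addrACA.
Qed.

Lemma jacobi_r x y z : comm (comm x y) z = comm x (comm y z) + comm (comm x z) y.
Proof. by rewrite jacobi -addrA [comm y _]commC addNr addr0. Qed.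

Lemma comm_assoc x y z : comm x z = 0 -> comm (comm x y) z = comm x (comm y z).
Proof. by move=> xz; rewrite jacobi_r xz comm0l addr0. Qed.

Lemma comm_swap x y z : comm y z = 0 -> comm (comm x y) z = comm (comm x z) y.
Proof. by move=> yz; rewrite jacobi_r yz comm0r add0r. Qed.

(** Leibniz rule for the square of [comm u]. When the other terms vanish it isolates twice the
    bracket of [comm u x] and [comm u y]. *)
Lemma comm_twice u x y : comm u (comm u (comm x y)) =
  comm (comm u (comm u x)) y + comm x (comm u (comm u y))
  + (comm (comm u x) (comm u y) + comm (comm u x) (comm u y)).
Proof.
rewrite (jacobi u x y) commDr (jacobi u (comm u x) y) (jacobi u x (comm u y)).
by rewrite (addrC (comm (comm u x) _) (comm x _)) addrACA.
Qed.

End CommutatorCalculus.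

Section DividedCommutator.
Variables (R : realType) (A : algType (CC R)).
Implicit Types (x y z w : A).

Lemma half_eq0 x : x + x = 0 -> x = 0.
Proof.
move=> xx; have : (2%:R : CC R) *: x = 0 by rewrite scaler_nat mulr2n.
by move/eqP; rewrite scaler_eq0 pnatr_eq0 => /eqP.
Qed.

Lemma divpow0 x : divpow x 0 = 1.
Proof. by rewrite /divpow expr0 invr1 scale1r. Qed.

Lemma divpowSl x m : x * divpow x m = m.+1%:R *: divpow x m.+1.
Proof.
rewrite /divpow -scalerAr -exprS scalerA factS natrM invfM mulrA mulfV ?mul1r //.
by rewrite pnatr_eq0.
Qed.

Lemma divpowSr x m : divpow x m * x = m.+1%:R *: divpow x m.+1.
Proof. by rewrite -divpowSl /divpow -scalerAr -scalerAl -exprS -exprSr. Qed.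

(** The map [comm^~ y] applied [t] times to [w] and divided by [t!], expanded so that only divided
    powers of [y] occur. *)
Definition divided_ad y w (t : nat) : A :=
  \sum_(j < t.+1) (-1) ^+ j *: (divpow y j * w * divpow y (t - j)).

Lemma comm_divided_ad y w t : comm (divided_ad y w t) y = t.+1%:R *: divided_ad y w t.+1.
Proof.
pose T j := (-1) ^+ j *: (divpow y j * w * divpow y (t.+1 - j)).
have -> : t.+1%:R *: divided_ad y w t.+1 =
    \sum_(j < t.+2) (t.+1 - j)%:R *: T j + \sum_(j < t.+2) j%:R *: T j.
  rewrite /divided_ad scaler_sumr -big_split; apply: eq_bigr => j _ /=.
  by rewrite -scalerDl -natrD subnK // -ltnS.
rewrite big_ord_recr /= subnn scale0r addr0 [X in _ + X]big_ord_recl /= scale0r add0r /=.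
rewrite /comm mulr_suml mulr_sumr -sumrN -!big_split; apply: eq_bigr => j _ /=.
have jt : (j <= t)%N by rewrite -ltnS.
congr (_ + _).
  rewrite /T -scalerAl -[_ * _ * y]mulrA divpowSr -scalerAr subSn //.
  by rewrite scalerA mulrC -scalerA.
rewrite /T /bump /= add1n subSS -scalerAr !mulrA divpowSl -!scalerAl [(-1) ^+ j.+1]exprS mulN1r.
rewrite scaleNr scalerN; congr (- _).
by rewrite [LHS]scalerA [X in X *: _]mulrC -[LHS]scalerA.
Qed.

(** As [comm x y] commutes with both [x] and [y], each bracket with [y] lowers the divided power of
    [x] by one and produces one factor [comm x y]; after [t] brackets only its [t]-th power is
    left. *)
Lemma divpow_comm x y t : comm x (comm x y) = 0 -> comm y (comm x y) = 0 ->
  divpow (comm x y) t = divided_ad y (divpow x t) t.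
Proof.
set z := comm x y => xz yz.
have zy k : comm (z ^+ k) y = 0.
  elim: k => [|k IHk]; first by rewrite expr0 /comm mul1r mulr1 subrr.
  by rewrite exprS commMl IHk mulr0 add0r [comm z y]commC yz oppr0 mul0r.
have xk k : comm (x ^+ k.+1) y = (x ^+ k * z) *+ k.+1.
  elim: k => [|k IHk]; first by rewrite expr0 mul1r.
  rewrite exprS commMl IHk mulrnAr mulrA -exprS -/z [RHS]mulrSr; congr (_ + _).
  apply/commrX/eqP; rewrite -subr_eq0; apply/eqP; move: xz; rewrite commC => /eqP.
  by rewrite oppr_eq0 => /eqP.
have dk k : comm (divpow x k.+1) y = divpow x k * z.
  rewrite /divpow [LHS](_ : _ = ((k.+1)`!%:R^-1) *: comm (x ^+ k.+1) y).
    rewrite xk -scalerMnr scalerMnl -scalerAl; congr (_ *: _).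
    by rewrite factS natrM invfM -[LHS]mulr_natr mulrAC mulVf ?mul1r // pnatr_eq0.
  by rewrite /comm scalerBr scalerAl scalerAr.
have ind k : (k <= t)%N -> k`!%:R *: divided_ad y (divpow x t) k = divpow x (t - k) * z ^+ k.
  elim: k => [|k IHk] kt.
    by rewrite subn0 mulr1 scale1r /divided_ad big_ord1 expr0 scale1r !divpow0 mul1r mulr1.
  rewrite factS mulnC natrM -scalerA -comm_divided_ad.
  rewrite [LHS](_ : _ = comm (k`!%:R *: divided_ad y (divpow x t) k) y); last first.
    by rewrite /comm scalerBr scalerAl scalerAr.
  by rewrite IHk ?(ltnW kt) // commMl zy mulr0 add0r -(subnSK kt) dk -mulrA -exprS.
have := ind t (leqnn t); rewrite subnn divpow0 mul1r => E.
by rewrite [LHS]/divpow -E scalerA mulVf ?scale1r // pnatr_eq0 -lt0n fact_gt0.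
Qed.

End DividedCommutator.

(** * Serre identities for root vectors *)

Section RootVectors.
Variables (R : realType) (n : nat) (A : algType (CC R)) (e : nat -> nat -> A).
Hypothesis rels : yangian_rels n e.
Local Notation E := (e_root e).

Lemma e_far i j r s : inI n i -> inI n j -> (i.+1 < j)%N || (j.+1 < i)%N ->
  comm (e i r) (e j s) = 0.
Proof.
move=> iI jI far; case: rels => _ [farE _]; apply: farE => //.
rewrite /cartan; have -> : (i == j) = false by lia.
have -> : (i == j.+1) = false by lia.
by have -> : (j == i.+1) = false by lia.
Qed.

Lemma e_serre i j r1 r2 s : inI n i -> inI n j -> (j == i.+1) || (i == j.+1) ->
  comm (e i r1) (comm (e i r2) (e j s)) + comm (e i r2) (comm (e i r1) (e j s)) = 0.
Proof.
move=> iI jI near; case: rels => _ [_]; apply => //.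
rewrite /cartan; have -> : (i == j) = false by lia.
by rewrite orbC near.
Qed.

Lemma e_serre0 i j r s : inI n i -> inI n j -> (j == i.+1) || (i == j.+1) ->
  comm (e i r) (comm (e i r) (e j s)) = 0.
Proof. by move=> iI jI near; apply/half_eq0/e_serre. Qed.

Lemma e_root_far i j r k s : is_root n (i, j) -> inI n k -> (j.+1 < k)%N || (k.+1 < i)%N ->
  comm (E i j r) (e k s) = 0.
Proof.
move=> /andP[/andP[/= i1 ij] jn] kI; elim: j ij jn => [|j IHj]; first by lia.
rewrite leq_eqVlt => /predU1P[<-|ij] jn far.
  by rewrite e_root_simple e_far // /inI i1.
have jI : inI n j.+1 by rewrite /inI jn.
rewrite e_rootS // comm_swap ?e_far //; last by lia.
by rewrite IHj ?comm0l //; lia.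
Qed.

Lemma e_root_serre_r i j r : is_root n (i, j) -> inI n j.+1 ->
  comm (comm (E i j r) (e j.+1 0)) (e j.+1 0) = 0.
Proof.
move=> ijr jI; have /andP[/andP[/= i1 ij] jn] := ijr.
case: j ij jn jI ijr => [|j]; first by lia.
rewrite leq_eqVlt => /predU1P[<-|ij] jn jI ijr.
  have iI : inI n i by rewrite /inI i1.
  by rewrite e_root_simple commC [comm (e i r) _]commC commNr opprK e_serre0 // eqxx orbT.
have jI' : inI n j.+1 by rewrite /inI jn.
have ijr' : is_root n (i, j) by rewrite /is_root /=; lia.
have X0 : comm (E i j r) (e j.+2 0) = 0 by rewrite e_root_far // ltnSn.
rewrite e_rootS // (comm_assoc _ X0) (comm_assoc _ X0).
have -> : comm (comm (e j.+1 0) (e j.+2 0)) (e j.+2 0) = 0; last exact: comm0r.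
by rewrite commC [comm (e j.+1 0) _]commC commNr opprK e_serre0 // eqxx orbT.
Qed.

(** Induction on the length of the root. With [x'] the shorter root vector, [comm_twice] is applied
    to [comm x' y = 0]; the square of [comm u] kills [x'] and [y], so the mixed bracket [xuuy]
    vanishes. *)
Lemma e_root_serre_l i j r : is_root n (i, j) -> inI n j.+1 ->
  comm (E i j r) (comm (E i j r) (e j.+1 0)) = 0.
Proof.
move=> ijr; have /andP[/andP[/= i1 ij] jn] := ijr.
elim: j ij jn ijr => [|j IHj]; first by lia.
rewrite leq_eqVlt => /predU1P[<-|ij] jn ijr jI.
  have iI : inI n i by rewrite /inI i1.
  by rewrite e_root_simple e_serre0 // eqxx.
have jI' : inI n j.+1 by rewrite /inI jn.
have ijr' : is_root n (i, j) by rewrite /is_root /=; lia.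
have X0 : comm (E i j r) (e j.+2 0) = 0 by rewrite e_root_far // ltnSn.
set u := e j.+1 0; set y := e j.+2 0; set x' := E i j r in X0 *.
have ux' : comm u (comm u x') = 0.
  by rewrite commC [comm u x']commC commNl opprK e_root_serre_r.
have uy : comm u (comm u y) = 0 by rewrite e_serre0 // eqxx.
have xuuy : comm (comm x' u) (comm u y) = 0.
  apply: half_eq0; rewrite [comm x' u]commC commNl -opprD; apply/eqP; rewrite oppr_eq0.
  by have := comm_twice u x' y; rewrite X0 ux' uy !comm0r comm0l !add0r => <-.
have x'x : comm (comm x' u) x' = 0 by rewrite commC IHj ?oppr0 //; lia.
by rewrite e_rootS // -/u -/x' (comm_assoc _ X0) jacobi x'x comm0l xuuy comm0r addr0.
Qed.

(** Both Serre identities hold exactly, not just up to lower loop degree, so [divpow_comm] expresses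
    the divided power through those of a shorter root vector and of a generator, with coefficients 1
    and -1. *)
Lemma Ybold_divpow_root i j r t : is_root n (i, j) -> Ybold n e (divpow (E i j r) t).
Proof.
move=> ijr; have /andP[/andP[/= i1 ij] jn] := ijr.
elim: j ij jn ijr t => [|j IHj]; first by lia.
rewrite leq_eqVlt => /predU1P[<-|ij] jn ijr t.
  by rewrite e_root_simple; apply: Yb_gen; rewrite /inI i1.
have jI : inI n j.+1 by rewrite /inI jn.
have ijr' : is_root n (i, j) by rewrite /is_root /=; lia.
rewrite e_rootS // divpow_comm; first last.
- by rewrite commC e_root_serre_r ?oppr0.
- exact: e_root_serre_l.
rewrite /divided_ad; apply: (big_ind (Ybold n e)).
- exact: Yb_zero.
- exact: Yb_add.
move=> k _; apply: Yb_scale.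
  suff: (-1) ^+ k \in @dyadic_pred R by move/asboolP.
  by rewrite rpredX ?rpredN1.
apply: Yb_mul; last exact: Yb_gen.
apply: Yb_mul; [exact: Yb_gen | apply: IHj => //; exact: ltnW].
Qed.

Lemma Ybold_Eh (h : fsupp_fun n) : Ybold n e (Eh e h).
Proof.
rewrite /Eh; apply: (big_ind (Ybold n e)); [exact: Yb_one | exact: Yb_mul |].
move=> x _; apply: Ybold_divpow_root.
by rewrite -surjective_pairing; apply: valP.
Qed.

End RootVectors.

(** * Straightening *)

Section Filtration.
Variables (R : realType) (n : nat) (A : algType (CC R)) (e : nat -> nat -> A).
Hypothesis rels : yangian_rels n e.
Local Notation E := (e_root e).
Implicit Types (x y z : A).

(* The bound on the total loop degree is strict: [Fil d] is spanned by monomials of degree < [d]. *)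
Inductive Fil : nat -> A -> Prop :=
| Fil_zero d : Fil d 0
| Fil_one : Fil 1 1
| Fil_add d x y : Fil d x -> Fil d y -> Fil d (x + y)
| Fil_scale d (c : CC R) x : Fil d x -> Fil d (c *: x)
| Fil_gen d i r x : inI n i -> Fil d x -> Fil (r + d) (e i r * x)
| Fil_weak d x : Fil d x -> Fil d.+1 x.

Lemma Fil_le d d' x : (d <= d')%N -> Fil d x -> Fil d' x.
Proof.
move=> /subnK <-; elim: (d' - d)%N => [//|k IHk] h.
by rewrite addSn; apply/Fil_weak/IHk.
Qed.

Lemma Fil0 d x : Fil d x -> d = 0%N -> x = 0.
Proof.
elim=> {d x} //.
- by move=> d x y _ IHx _ IHy d0; rewrite IHx // IHy // addr0.
- by move=> d c x _ IHx d0; rewrite IHx // scaler0.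
- by move=> d i r x _ _ IHx d0; rewrite IHx ?mulr0 //; lia.
Qed.

Lemma Fil_opp d x : Fil d x -> Fil d (- x).
Proof. by move=> h; rewrite -scaleN1r; apply: Fil_scale. Qed.

Lemma Fil_sub d x y : Fil d x -> Fil d y -> Fil d (x - y).
Proof. by move=> hx hy; apply/Fil_add/Fil_opp. Qed.

Lemma Fil_half d x : Fil d (x + x) -> Fil d x.
Proof.
move=> h; have -> : x = (2%:R^-1 : CC R) *: (x + x); last exact: Fil_scale.
by rewrite -[x + x]mulr2n -[x *+ 2]scaler_nat scalerA mulVf ?scale1r // pnatr_eq0.
Qed.

Lemma Fil_mul d d' x y : Fil d x -> Fil d' y -> Fil (d + d').-1 (x * y).
Proof.
move=> hx hy; elim: hx => {d x}.
- by move=> d; rewrite mul0r; apply: Fil_zero.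
- by rewrite mul1r add1n.
- by move=> d x z _ IHx _ IHz; rewrite mulrDl; apply: Fil_add.
- by move=> d c x _ IHx; rewrite -scalerAl; apply: Fil_scale.
- move=> d i r x iI hx IHx; rewrite -mulrA.
  have [d0|dpos] := posnP (d + d')%N; last by apply: Fil_le (Fil_gen r iI IHx); lia.
  have d0' : d = 0%N by lia.
  by rewrite (Fil0 hx d0') mul0r mulr0; apply: Fil_zero.
- by move=> d x _; apply: Fil_le; lia.
Qed.

Lemma Fil_e i r : inI n i -> Fil r.+1 (e i r).
Proof. by move=> iI; rewrite -[e i r]mulr1 -addn1; apply: Fil_gen => //; apply: Fil_one. Qed.

Lemma Fil_comm d d' x y : Fil d x -> Fil d' y -> Fil (d + d').-1 (comm x y).
Proof. by move=> hx hy; apply: Fil_sub; [|rewrite addnC]; apply: Fil_mul. Qed.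

Lemma Fil_comml d r x y : Fil d x -> Fil r.+1 y -> Fil (d + r) (comm x y).
Proof. by move=> hx hy; have := Fil_comm hx hy; rewrite addnS. Qed.

Lemma Fil_commr d r x y : Fil r.+1 x -> Fil d y -> Fil (r + d) (comm x y).
Proof. exact: Fil_comm. Qed.

Lemma Fil_root i j r : is_root n (i, j) -> Fil r.+1 (E i j r).
Proof.
move=> /andP[/andP[/= i1 ij] jn]; elim: j ij jn => [|j IHj]; first by lia.
rewrite leq_eqVlt => /predU1P[<-|ij] jn.
  by rewrite e_root_simple; apply: Fil_e; rewrite /inI i1.
rewrite e_rootS // -[r.+1]addn0; apply: Fil_comml; last by apply: Fil_e; rewrite /inI jn.
by apply: IHj => //; apply: ltnW.
Qed.

Definition eqFil d x y := Fil d (x - y).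

Lemma eqFil_refl d x : eqFil d x x.
Proof. by rewrite /eqFil subrr; apply: Fil_zero. Qed.

Lemma eqFil_trans d x y z : eqFil d x y -> eqFil d y z -> eqFil d x z.
Proof. by rewrite /eqFil => h1 h2; rewrite -(subrKA y); apply: Fil_add. Qed.

Lemma eqFil_sym d x y : eqFil d x y -> eqFil d y x.
Proof. by rewrite /eqFil => h; rewrite -opprB; apply: Fil_opp. Qed.

Lemma eqFil_opp d x y : eqFil d x y -> eqFil d (- x) (- y).
Proof. by rewrite /eqFil -opprD; apply: Fil_opp. Qed.

Lemma eqFil0 d x y : eqFil d x y -> Fil d y -> Fil d x.
Proof. by move=> h hy; rewrite -(subrK y x); apply: Fil_add. Qed.

Lemma eqFil_comml d r x x' y : eqFil d x x' -> Fil r.+1 y ->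
  eqFil (d + r) (comm x y) (comm x' y).
Proof. by move=> h hy; rewrite /eqFil -commNl -commDl; apply: Fil_comml. Qed.

Lemma eqFil_commr d r x y y' : Fil r.+1 x -> eqFil d y y' ->
  eqFil (r + d) (comm x y) (comm x y').
Proof. by move=> hx h; rewrite /eqFil -commNr -commDr; apply: Fil_commr. Qed.

Lemma e_shift1 i j r s : inI n i -> inI n j ->
  eqFil (r + s).+1 (comm (e i r.+1) (e j s)) (comm (e i r) (e j s.+1)).
Proof.
move=> iI jI; have [+ _] := rels; rewrite /eqFil => -> //; apply: Fil_scale.
have := Fil_mul (Fil_e r iI) (Fil_e s jI); have := Fil_mul (Fil_e s jI) (Fil_e r iI).
by rewrite !addSn !addnS addnC /= => h1 h2; apply: Fil_add.
Qed.

Lemma e_shift i j r s : inI n i -> inI n j ->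
  eqFil (r + s) (comm (e i r) (e j s)) (comm (e i (r + s)) (e j 0)).
Proof.
move=> iI jI; elim: s r => [|s IHs] r; first by rewrite addn0; apply: eqFil_refl.
rewrite addnS; apply: eqFil_trans (eqFil_sym (e_shift1 _ _ iI jI)) _.
by rewrite -addSn.
Qed.

(** By [e_shift] the bracket depends only on [r + s] up to lower terms, so it is symmetric as well
    as antisymmetric in [r] and [s]. *)
Lemma e_same i r s : inI n i -> Fil (r + s) (comm (e i r) (e i s)).
Proof.
move=> iI; apply: Fil_half; rewrite {2}commC.
apply: (@eqFil_trans _ _ (comm (e i (r + s)) (e i 0))); first exact: e_shift.
by rewrite addnC; apply/eqFil_sym/e_shift.
Qed.

(* Serre's relation says that [e_i,r [e_i,s e_j]] is antisymmetric in [r, s], while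
   [e_same] makes it symmetric up to lower terms. *)
Lemma e_serre_low i j r1 r2 s : inI n i -> inI n j -> (j == i.+1) || (i == j.+1) ->
  Fil (r1 + r2 + s) (comm (e i r1) (comm (e i r2) (e j s))).
Proof.
move=> iI jI near; apply: Fil_half.
have -> : comm (e i r1) (comm (e i r2) (e j s)) + comm (e i r1) (comm (e i r2) (e j s))
  = comm (comm (e i r1) (e i r2)) (e j s).
  have := e_serre rels r1 r2 s iI jI near => /eqP; rewrite addr_eq0 => /eqP E12.
  by rewrite {1}jacobi E12 addrK.
by apply: Fil_comml; [exact: e_same | exact: Fil_e].
Qed.

Lemma root_pred i j : is_root n (i, j.+1) -> (i <= j)%N -> is_root n (i, j) /\ inI n j.+1.
Proof. by rewrite /is_root /inI /=; lia. Qed.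

(** The part of the root vector before its last two simple factors commutes with [e j s], which
    leaves [e_serre_low]. *)
Lemma root_end_low i j r s : is_root n (i, j) -> Fil (r + s) (comm (E i j r) (e j s)).
Proof.
move=> ijr; have /andP[/andP[/= i1 ij] jn] := ijr.
case: j ij jn ijr => [|j]; first by lia.
rewrite leq_eqVlt => /predU1P[<-|ij] jn ijr.
  by rewrite e_root_simple; apply: e_same; rewrite /inI i1.
have [ijr' jI] := root_pred ijr ij.
rewrite e_rootS //.
have base k t : inI n k -> k.+1 = j.+1 -> Fil (t + s) (comm (comm (e k t) (e j.+1 0)) (e j.+1 s)).
  move=> kI kj; rewrite commC [comm (e k t) _]commC commNr opprK.
  have := e_serre_low s 0 t jI kI; rewrite addn0 addnC; apply.
  by rewrite kj eqxx orbT.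
move: ij; rewrite ltnS leq_eqVlt => /predU1P[ijE|ij].
  by rewrite -[in e_root _ _ _ _]ijE e_root_simple; apply: base; rewrite /inI; lia.
case: j ij jn ijr ijr' jI base => [|j]; first by lia.
rewrite ltnS => ij jn ijr ijr' jI base.
have [ijr'' jI'] := root_pred ijr' ij.
have X0 t : comm (E i j r) (e j.+2 t) = 0 by rewrite (e_root_far rels) // ltnSn.
rewrite e_rootS // (comm_assoc _ (X0 0)) (comm_assoc _ (X0 s)).
apply: Fil_commr; first exact: Fil_root.
exact: (base j.+1 0).
Qed.

Lemma root_start_low i j r s : is_root n (i, j) -> Fil (r + s) (comm (E i j r) (e i s)).
Proof.
move=> ijr; have /andP[/andP[/= i1 ij] jn] := ijr.
elim: j ij jn ijr => [|j IHj]; first by lia.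
rewrite leq_eqVlt => /predU1P[<-|ij] jn ijr.
  by rewrite e_root_simple; apply: e_same; rewrite /inI i1.
have [ijr' jI] := root_pred ijr ij.
have iI : inI n i by rewrite /inI; lia.
rewrite e_rootS //.
move: ij; rewrite ltnS leq_eqVlt => /predU1P[ij|ij].
  rewrite -ij e_root_simple commC; apply: Fil_opp.
  have := e_serre_low s r 0 iI jI; rewrite -ij addn0 addnC; apply.
  by rewrite eqxx.
rewrite comm_swap; last by apply: (e_far rels) => //; lia.
rewrite -[(r + s)%N]addn0; apply: Fil_comml; last exact: Fil_e.
by apply: IHj; rewrite // ltnW.
Qed.

Lemma root_mid_low i j k r s : is_root n (i, j) -> (i < k < j)%N ->
  Fil (r + s) (comm (E i j r) (e k s)).
Proof.
move=> ijr; have /andP[/andP[/= i1 ij] jn] := ijr.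
elim: j ij jn ijr => [|j IHj]; first by lia.
move=> ij jn ijr /andP[ik kj0]; have kI : inI n k by rewrite /inI; lia.
move: kj0; rewrite ltnS leq_eqVlt => /predU1P[kj|kj]; last first.
  have [ijr' jI] : is_root n (i, j) /\ inI n j.+1 by apply: root_pred => //; lia.
  rewrite e_rootS; last by lia.
  rewrite comm_swap; last by apply: (e_far rels) => //; lia.
  rewrite -[(r + s)%N]addn0; apply: Fil_comml; last exact: Fil_e.
  by apply: IHj => //; rewrite ?ik //; lia.
have [ijr' jI] : is_root n (i, j) /\ inI n j.+1 by apply: root_pred => //; lia.
rewrite -kj in ijr' jI ij jn ijr *.
rewrite e_rootS; last by lia.
rewrite jacobi_r; apply: Fil_add; last first.
  rewrite -[(r + s)%N]addn0; apply: Fil_comml; last exact: Fil_e.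
  exact: root_end_low.
(* The loop degree [s] is moved from [e k] to [e k.+1], which makes both occurrences of [e k] have
   loop degree 0. They form the [u] to which [comm_twice] is then applied. *)
apply: (@eqFil0 _ _ (comm (E i k r) (comm (e k.+1 s) (e k 0)))).
  by apply: eqFil_commr; [exact: Fil_root | have := e_shift 0 s jI kI; rewrite add0n].
case: k ik kI {kj IHj} ijr' jI ij jn ijr => [|k]; first by lia.
rewrite ltnS => ik kI ijk kI' _ _ _.
have [ijk' _] := root_pred ijk ik.
rewrite e_rootS //; set x' := E i k r; set u := e k.+1 0; set v := e k.+2 s.
have uux : Fil r (comm u (comm u x')).
  rewrite commC [comm u x']commC commNl opprK -[r]addn0 -e_rootS //.
  exact: root_end_low.
have uuv : comm u (comm u v) = 0 by rewrite (e_serre0 rels) // eqxx.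
have x'v : comm x' v = 0 by rewrite (e_root_far rels) // ltnSn.
apply: Fil_half; rewrite [comm v u]commC [comm x' u]commC commNl commNr opprK.
have := comm_twice u x' v; rewrite x'v uuv !comm0r addr0 => /eqP.
rewrite eq_sym addrC addr_eq0 => /eqP ->; apply: Fil_opp.
by apply: Fil_comml => //; apply: Fil_e.
Qed.

(** [e_shift] hands the loop degree [s] from each simple factor to the preceding one until it
    reaches the first. *)
Lemma root_next i j r s : is_root n (i, j.+1) -> (i <= j)%N ->
  eqFil (r + s) (comm (E i j r) (e j.+1 s)) (E i j.+1 (r + s)).
Proof.
move=> ijr ij; have [ijr' jI] := root_pred ijr ij; have /andP[/andP[/= i1 _] jn] := ijr'.
elim: j ij jn ijr ijr' jI r s => [|j IHj]; first by lia.
move=> ij jn ijr ijr' jI r s; move: ij; rewrite leq_eqVlt => /predU1P[ij|ij].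
  rewrite ij (e_rootS _ _ (leqnn j.+1)) !e_root_simple; apply: e_shift => //.
rewrite ltnS in ij; have [ijr'' jI'] := root_pred ijr' ij.
have X0 t : comm (E i j r) (e j.+2 t) = 0 by rewrite (e_root_far rels) // ltnSn.
rewrite e_rootS // (comm_assoc _ (X0 s)).
apply: (@eqFil_trans _ _ (comm (E i j r) (comm (e j.+1 s) (e j.+2 0)))).
  apply: eqFil_commr; first exact: Fil_root.
  by have := e_shift 0 s jI' jI; rewrite add0n.
have ij' : (i <= j.+1)%N by apply: leqW.
rewrite -(comm_assoc _ (X0 0)) (e_rootS _ _ ij').
rewrite -[X in eqFil X]addn0; apply: eqFil_comml; last exact: Fil_e.
by apply: IHj => //; lia.
Qed.

Lemma root_prev i j r s : is_root n (i.+1, j) -> inI n i ->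
  eqFil (r + s) (comm (E i.+1 j r) (e i s)) (- E i j (r + s)).
Proof.
move=> ijr iI; have /andP[/andP[/= i1 ij] jn] := ijr.
elim: j ij jn ijr => [|j IHj]; first by lia.
rewrite leq_eqVlt => /predU1P[ij|ij] jn ijr.
  rewrite -ij e_root_simple commC e_rootS ?e_root_simple //; apply: eqFil_opp.
  by rewrite addnC; apply: e_shift; rewrite // /inI ij jn.
have [ijr' jI] := root_pred ijr ij.
have ij' : (i < j)%N by [].
rewrite (e_rootS _ _ ij') comm_swap; last by apply: (e_far rels) => //; lia.
rewrite e_rootS; last by lia.
rewrite -commNl -[X in eqFil X]addn0; apply: eqFil_comml; last exact: Fil_e.
by apply: IHj; rewrite // ltnW.
Qed.

(** Modulo lower terms this is the degree [d] part of n_+[t]. Its closure under brackets records the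
    Lie algebra structure without structure constants. *)
Inductive RootSpan (d : nat) : A -> Prop :=
| RS_low x : Fil d x -> RootSpan d x
| RS_root i j : is_root n (i, j) -> RootSpan d (E i j d)
| RS_add x y : RootSpan d x -> RootSpan d y -> RootSpan d (x + y)
| RS_scale (c : CC R) x : RootSpan d x -> RootSpan d (c *: x).

Lemma RS_eqFil d x y : eqFil d x y -> RootSpan d y -> RootSpan d x.
Proof. by move=> h hy; rewrite -(subrK y x); apply: RS_add => //; apply: RS_low. Qed.

Lemma RS_opp d x : RootSpan d x -> RootSpan d (- x).
Proof. by move=> h; rewrite -scaleN1r; apply: RS_scale. Qed.

Lemma RS_comm_simple d k s x : inI n k -> RootSpan d x -> RootSpan (d + s) (comm x (e k s)).
Proof.
move=> kI; elim=> {x}.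
- by move=> x hx; apply: RS_low; apply: Fil_comml => //; apply: Fil_e.
- move=> i j ijr; have /andP[/andP[/= i1 ij] jn] := ijr.
  have [far|] := boolP ((j.+1 < k) || (k.+1 < i))%N.
    by rewrite (e_root_far rels) //; apply/RS_low/Fil_zero.
  rewrite negb_or -!leqNgt => /andP[kj ik].
  have [kE|kj'] := eqVneq k j.+1.
    have ijr' : is_root n (i, j.+1) by rewrite /is_root /= -kE; move: kI; rewrite /inI; lia.
    by rewrite kE; apply: RS_eqFil (root_next _ _ ijr' ij) _; apply: RS_root.
  have [iE|ik'] := eqVneq i k.+1.
    rewrite iE in ijr *; apply: RS_eqFil (root_prev _ _ ijr kI) _.
    by apply/RS_opp/RS_root; move: kI ijr; rewrite /inI /is_root /=; lia.
  apply: RS_low; have [->|kj''] := eqVneq k j; first exact: root_end_low.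
  have [->|ik''] := eqVneq k i; first exact: root_start_low.
  by apply: root_mid_low => //; lia.
- by move=> x y _ IHx _ IHy; rewrite commDl; apply: RS_add.
- move=> c x _ IHx; rewrite (_ : comm _ _ = c *: comm x (e k s)); first exact: RS_scale.
  by rewrite /comm scalerBr scalerAl scalerAr.
Qed.

Lemma RS_comm_root d i j r x : is_root n (i, j) -> RootSpan d x ->
  RootSpan (d + r) (comm x (E i j r)).
Proof.
move=> ijr; have /andP[/andP[/= i1 ij] jn] := ijr.
elim: j ij jn ijr d x => [|j IHj]; first by lia.
rewrite leq_eqVlt => /predU1P[<-|ij] jn ijr d x hx.
  by rewrite e_root_simple; apply: RS_comm_simple; rewrite // /inI i1.
have [ijr' jI] := root_pred ijr ij.
rewrite e_rootS // jacobi; apply: RS_add.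
  rewrite -[(d + r)%N]addn0; apply: RS_comm_simple => //.
  by apply: IHj => //; exact: ltnW.
rewrite commC; apply: RS_opp; rewrite -[d]addn0.
by apply: IHj => //; [exact: ltnW | exact: RS_comm_simple].
Qed.

End Filtration.

(** * Rewriting words in root vectors as combinations of the [Eh] *)

Section Straightening.
Variables (R : realType) (n : nat) (A : algType (CC R)) (e : nat -> nat -> A).
Hypothesis rels : yangian_rels n e.
Local Notation Fil := (Fil n e).
Implicit Types (x y z : A) (l p q : seq (rkey n)) (h : fsupp_fun n).

Inductive EhSpan : A -> Prop :=
| ES_zero : EhSpan 0
| ES_Eh h : EhSpan (Eh e h)
| ES_add x y : EhSpan x -> EhSpan y -> EhSpan (x + y)
| ES_scale (c : CC R) x : EhSpan x -> EhSpan (c *: x).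

Definition letter (k : rkey n) : A := e_root e (val k.1).1 (val k.1).2 k.2.
Definition word l : A := \prod_(k <- l) letter k.
Definition wdeg l : nat := \sum_(k <- l) k.2.

Lemma word_cat p q : word (p ++ q) = word p * word q.
Proof. exact: big_cat. Qed.

Lemma word_cons k l : word (k :: l) = letter k * word l.
Proof. exact: big_cons. Qed.

Lemma wdeg_cat p q : wdeg (p ++ q) = (wdeg p + wdeg q)%N.
Proof. exact: big_cat. Qed.

Lemma wdeg_cons k l : wdeg (k :: l) = (k.2 + wdeg l)%N.
Proof. exact: big_cons. Qed.

Lemma letter_root (k : rkey n) : is_root n ((val k.1).1, (val k.1).2).
Proof. by rewrite -surjective_pairing; apply: valP. Qed.

Lemma Fil_word l : Fil (wdeg l).+1 (word l).
Proof.
elim: l => [|k l IHl]; first by rewrite /word /wdeg !big_nil; apply: Fil_one.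
rewrite word_cons wdeg_cons; have := Fil_mul (Fil_root e k.2 (letter_root k)) IHl.
by rewrite addSn addnS.
Qed.

Lemma Fil_ind_word (P : A -> Prop) d : P 0 -> (forall x y, P x -> P y -> P (x + y)) ->
  (forall (c : CC R) x, P x -> P (c *: x)) ->
  (forall l, (wdeg l < d)%N -> P (word l)) -> forall x, Fil d x -> P x.
Proof.
move=> P0 PD PZ Pw x hx.
(* [P] is not assumed stable under left multiplication by generators, so the induction on [Fil]
   first builds an explicit combination of words. *)
have [r [xs [c [xsd ->]]]] : exists r (xs : 'I_r -> seq (rkey n)) (c : 'I_r -> CC R),
    (forall i, wdeg (xs i) < d)%N /\ x = \sum_i c i *: word (xs i).
  elim: hx {P P0 PD PZ Pw} => {d x}.
  - by move=> d; exists 0%N, (fun=> [::]), (fun=> 0); split=> [[]|]; rewrite ?big_ord0.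
  - exists 1%N, (fun=> [::]), (fun=> 1); split=> [i|]; first by rewrite /wdeg big_nil.
    by rewrite big_ord1 /word big_nil scale1r.
  - move=> d x y _ [r [xs [c [xsd ->]]]] _ [r' [xs' [c' [xsd' ->]]]].
    exists (r + r')%N, (fun i => match split i with inl j => xs j | inr j => xs' j end),
      (fun i => match split i with inl j => c j | inr j => c' j end).
    split=> [i|]; first by case: split.
    rewrite big_split_ord /=; congr (_ + _); apply: eq_bigr => i _.
      by rewrite (unsplitK (inl i)).
    by rewrite (unsplitK (inr i)).
  - move=> d a x _ [r [xs [c [xsd ->]]]]; exists r, xs, (fun i => a * c i); split=> //.
    by rewrite scaler_sumr; apply: eq_bigr => i _; rewrite scalerA.
  - move=> d i r x iI _ [r' [xs [c [xsd ->]]]].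
    have ri : is_root n (i, i) by move: iI; rewrite /inI /is_root /=; lia.
    exists r', (fun j => (exist _ (i, i) ri : proot n, r) :: xs j), c; split=> [j|].
      by rewrite wdeg_cons /= ltn_add2l.
    rewrite mulr_sumr; apply: eq_bigr => j _.
    by rewrite word_cons /letter /= e_root_simple scalerAr.
  - move=> d x _ [r [xs [c [xsd ->]]]]; exists r, xs, c; split=> // i.
    by rewrite ltnW // ltnS.
apply: (big_ind P) => // i _; apply: PZ; exact: Pw.
Qed.

Definition mult_fun l : fsupp_fun n := [fsfun k in seq_fset tt l => count_mem k l].

Lemma mult_funE l k : mult_fun l k = count_mem k l.
Proof.
rewrite fsfun_fun seq_fsetE; case: ifP => // /negbT kl.
by apply/esym/count_memPn.
Qed.

Lemma Eh_word h : word (flatten [seq nseq (h k) k | k <- fs_keys h])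
  = (\prod_(k <- fs_keys h) (h k)`!%:R : CC R) *: Eh e h.
Proof.
rewrite /Eh -/(fs_keys h); elim: (fs_keys h) => [|k ks IH].
  by rewrite /word /= !big_nil scale1r.
rewrite /= word_cat IH !big_cons -scalerAr [in RHS]mulrC -[RHS]scalerA; congr (_ *: _).
rewrite scalerAl /divpow scalerA mulfV ?pnatr_eq0 -?lt0n ?fact_gt0 // scale1r; congr (_ * _).
by rewrite /word big_nseq iter_mulr mulr1.
Qed.

Section Step.
Variables (d N : nat).
Hypothesis lower_deg : forall x, Fil d x -> EhSpan x.
Hypothesis shorter : forall l, (wdeg l <= d)%N -> (size l < N)%N -> EhSpan (word l).

(** Putting a bracket of two letters in their place yields either words with one letter less or
    terms of smaller loop degree; the two hypotheses of the section cover these cases. *)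
Lemma ES_bracket p q r x : (wdeg p + r + wdeg q <= d)%N -> ((size p + size q).+1 < N)%N ->
  RootSpan n e r x -> EhSpan (word p * x * word q).
Proof.
move=> dle sN; elim=> {x}.
- move=> x hx; apply/lower_deg/(@Fil_le _ _ _ _ (wdeg p + r + wdeg q)) => //.
  by have := Fil_mul (Fil_mul (Fil_word p) hx) (Fil_word q); rewrite !addSn addnS.
- move=> i j ijr; rewrite -mulrA.
  pose k : rkey n := (exist _ (i, j) ijr, r).
  have -> : e_root e i j r * word q = word (k :: q) by rewrite word_cons.
  rewrite -word_cat; apply: shorter; first by rewrite wdeg_cat wdeg_cons addnA.
  by rewrite size_cat /= addnS.
- by move=> x y _ IHx _ IHy; rewrite mulrDr mulrDl; apply: ES_add.
- by move=> c x _ IHx; rewrite -scalerAr -scalerAl; apply: ES_scale.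
Qed.

Lemma ES_swap p k k' q : (wdeg (p ++ k :: k' :: q) <= d)%N -> (size (p ++ k :: k' :: q) <= N)%N ->
  EhSpan (word (p ++ k :: k' :: q) - word (p ++ k' :: k :: q)).
Proof.
rewrite wdeg_cat size_cat !wdeg_cons /= => dle sN.
rewrite !word_cat !word_cons -mulrBr !mulrA -mulrBl mulrA.
apply: (@ES_bracket _ _ (k.2 + k'.2)); [lia | lia |].
by apply: RS_comm_root; [|exact: letter_root|apply: RS_root; exact: letter_root].
Qed.

Lemma ES_move p k q q' : (wdeg (p ++ k :: q ++ q') <= d)%N -> (size (p ++ k :: q ++ q') <= N)%N ->
  EhSpan (word (p ++ k :: q ++ q') - word (p ++ q ++ k :: q')).
Proof.
elim: q p => [|k' q IHq] p /= dle sN; first by rewrite subrr; apply: ES_zero.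
rewrite -(subrKA (word (p ++ k' :: k :: q ++ q'))); apply: ES_add; first exact: ES_swap.
rewrite -![p ++ k' :: _]cat_rcons; apply: IHq.
  by move: dle; rewrite cat_rcons !wdeg_cat !wdeg_cons; lia.
by move: sN; rewrite cat_rcons !size_cat /=.
Qed.

Lemma ES_perm p l l' : perm_eq l l' -> (wdeg (p ++ l) <= d)%N -> (size (p ++ l) <= N)%N ->
  EhSpan (word (p ++ l) - word (p ++ l')).
Proof.
elim: l p l' => [|k l IHl] p l' ll'.
  by move: ll'; rewrite perm_sym => /perm_nilP ->; rewrite subrr => _ _; apply: ES_zero.
have kl' : k \in l' by rewrite -(perm_mem ll') mem_head.
case/splitPr: kl' ll' => l1 l2 ll' dle sN.
have pk : perm_eq (l1 ++ k :: l2) (k :: l1 ++ l2) by rewrite -cat1s perm_catCA.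
have pl : perm_eq l (l1 ++ l2) by rewrite -(perm_cons k) (perm_trans ll').
have pp : perm_eq (p ++ k :: l) (p ++ k :: l1 ++ l2) by rewrite perm_cat2l perm_cons.
rewrite -(subrKA (word (p ++ k :: l1 ++ l2))); apply: ES_add.
  by rewrite -!cat_rcons; apply: IHl; rewrite // cat_rcons.
by apply: ES_move; [rewrite /wdeg -(perm_big _ pp) | rewrite -(perm_size pp)].
Qed.

Lemma ES_word l : (wdeg l <= d)%N -> (size l <= N)%N -> EhSpan (word l).
Proof.
move=> dle sN; pose h := mult_fun l.
have lh : perm_eq l (flatten [seq nseq (h k) k | k <- fs_keys h]).
  apply/allP => k _ /=; rewrite count_flatten_nseq ?fs_keys_uniq // mem_fs_keys.
  by rewrite -mult_funE -/h; case: finsuppP.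
rewrite -(subrK (word (flatten [seq nseq (h k) k | k <- fs_keys h])) (word l)).
apply: ES_add; first exact: (@ES_perm [::]).
by rewrite Eh_word; apply/ES_scale/ES_Eh.
Qed.

End Step.

Lemma EhSpan_Fil d x : Fil d x -> EhSpan x.
Proof.
elim: d x => [|d IHd] x; first by move/Fil0 ->; [exact: ES_zero | ].
apply: Fil_ind_word => [|||l]; [exact: ES_zero | exact: ES_add | exact: ES_scale |].
(* Inner induction on the length of words, at fixed loop degree. *)
rewrite ltnS; move: {2}(size l) (leqnn (size l)) => N.
elim: N l => [|N IHN] l sN dl; apply: (@ES_word d (size l)) => // l' dl' sl'; first by lia.
by apply: IHN => //; lia.
Qed.

Lemma Ybold_Fil y : Ybold n e y -> exists d, Fil d y.
Proof.
elim=> {y}.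
- move=> i r t iI; have [d hd] : exists d, Fil d (e i r ^+ t).
    elim: t => [|t [d IHt]]; first by exists 1%N; apply: Fil_one.
    by exists (r + d)%N; rewrite exprS; apply: Fil_gen.
  by exists d; apply: Fil_scale.
- by exists 1%N; apply: Fil_one.
- by exists 0%N; apply: Fil_zero.
- move=> x y _ [d hx] _ [d' hy]; exists (maxn d d'); apply: Fil_add.
    exact: Fil_le (leq_maxl _ _) hx.
  exact: Fil_le (leq_maxr _ _) hy.
- by move=> x y _ [d hx] _ [d' hy]; exists (d + d').-1; apply: Fil_mul.
- by move=> c x _ _ [d hx]; exists d; apply: Fil_scale.
Qed.

Lemma EhSpan_sum y : EhSpan y -> exists (s : seq (fsupp_fun n)) (c : fsupp_fun n -> CC R),
  uniq s /\ y = \sum_(h <- s) c h *: Eh e h.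
Proof.
elim=> {y}.
- by exists [::], (fun=> 0); rewrite big_nil.
- by move=> h; exists [:: h], (fun=> 1); rewrite big_seq1 scale1r.
- move=> x y _ [s [c [us ->]]] _ [s' [c' [us' ->]]].
  have ext (t : seq (fsupp_fun n)) (b : fsupp_fun n -> CC R) : uniq t -> {subset t <= s ++ s'} ->
      \sum_(h <- t) b h *: Eh e h
      = \sum_(h <- undup (s ++ s')) (if h \in t then b h else 0) *: Eh e h.
    move=> ut sub; rewrite [RHS](bigID (mem t)) /= [X in _ + X]big1 ?addr0; last first.
      by move=> h /negPf ->; rewrite scale0r.
    rewrite -[RHS]big_filter; under [RHS]eq_big_seq => h.
      rewrite mem_filter => /andP[-> _]; over.
    apply: perm_big; apply: uniq_perm => // [|h]; first by rewrite filter_uniq ?undup_uniq.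
    by rewrite mem_filter mem_undup; apply/idP/andP => [ht|[]//]; split=> //; apply: sub.
  exists (undup (s ++ s')),
    (fun h => (if h \in s then c h else 0) + (if h \in s' then c' h else 0)).
  split; first exact: undup_uniq.
  under [RHS]eq_bigr do rewrite scalerDl.
  rewrite big_split /= -!ext // => h; rewrite mem_cat => ->; rewrite ?orbT //.
- move=> a x _ [s [c [us ->]]]; exists s, (fun h => a * c h); split=> //.
  by rewrite scaler_sumr; apply: eq_bigr => h _; rewrite scalerA.
Qed.

End Straightening.

Theorem theorem2p8 (R : realType) (n : nat) (A : algType (complex R))
    (e : nat -> nat -> A) :
  (2 <= n)%N -> is_Yplus n e ->
  dyadic_basis (Ybold n e) (@Eh R n A e).
Proof.
move=> _ yang; have rels := yang.1.
split; first exact: Ybold_Eh.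
split=> [y Yy|s c us _ sum0 h hs].
  have [d yd] := Ybold_Fil Yy.
  have [s [c [us yE]]] := EhSpan_sum (EhSpan_Fil rels yd).
  (* The value 0 off [s] makes the coefficient function dyadic everywhere. *)
  exists s, (fun h => if h \in s then c h else 0); split=> [h|].
    case: ifP => [hs|_]; last by exists 0, 0%N; rewrite mul0r.
    by apply: (Ybold_coefs_dyadic yang (Ybold_Eh rels) us) hs; rewrite -yE.
  by rewrite yE; apply: eq_big_seq => h ->.
apply/eqP/contraT => ch0; case: (@third_not_dyadic R).
(* The relation is rescaled so that its coefficient at [h] becomes 1/3. The sum is still 0, which
   lies in the integral form, so 1/3 would be dyadic. *)
have -> : 3%:R^-1 = (3%:R * c h)^-1 * c h.
  by rewrite invfM -mulrA mulVf // mulr1.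
apply: (Ybold_coefs_dyadic (c := fun h' => (3%:R * c h)^-1 * c h') yang (Ybold_Eh rels) us _ hs).
under eq_bigr do rewrite -scalerA.
by rewrite -scaler_sumr sum0 scaler0; apply: Yb_zero.
Qed.
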